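(* Fix $\lambda>0$ and consider the sequence of random operators $H_M$ as $M\to\infty$. (1) Let $S(\lambda)=\{-1\}\cup[-\lambda,\lambda]$. For every $\varepsilon>0$, $$\lim_{M\to\infty}\mathbb{P}\left(d_H(\sigma(H_M),S(\lambda))>\varepsilon\right)=0 .$$ (2) The ground-state energy $\min\sigma(H_M)$ and the corresponding ground-state eigenfunction $\psi_0$ of $H_M$ satisfy, with asymptotically full probability: - if $\lambda\in(0,1)$: $$\min\sigma(H_M)=-1-\kappa_M^2+\mathcal{O}(\kappa_M^4),\qquad \frac{\|\psi_0\|_2}{\|\psi_0\|_\infty}=\Theta(\sqrt{M});$$ - if $\lambda\in(1,\infty)$: $$\min\sigma(H_M)=\min\sigma(\kappa_M V)+\frac{\mathcal{O}(1)}{M},\qquad 1\le\frac{\|\psi_0\|_2}{\|\psi_0\|_\infty}\le 1+\frac{\mathcal{O}(1)}{\kappa_M\sqrt{M}} .$$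
   Context: For $M\ge2$ and $\lambda>0$, $\kappa_M:=\lambda/\sqrt{2\ln M}$ and $H_M:=-|\varphi_0\rangle\langle\varphi_0|+\kappa_M V$ is the random $M\times M$ matrix in which $\varphi_0=(1,1,\dots,1)/\sqrt{M}$ and $V$ is the diagonal matrix with i.i.d. standard Gaussian entries $V(1),\dots,V(M)$. $\sigma(\cdot)$ denotes the spectrum. For $I,J\subset\mathbb{R}$ the Hausdorff distance is $d_H(I,J)=\max\{\sup_{x\in I}\inf_{y\in J}|x-y|,\ \sup_{y\in J}\inf_{x\in I}|x-y|\}$. $\|\psi\|_2$ and $\|\psi\|_\infty$ are the usual $\ell^2$ and maximum norms on $\mathbb{C}^M$. Probabilistic Landau notation: $f_M=\mathcal{O}(g_M)$ means that there is a constant $C<\infty$, independent of the realization of the randomness (and of $M$), such that $|f_M|\le C g_M$ for all sufficiently large $M$ except on events whose probability tends to $0$ as $M\to\infty$. $f_M=\Theta(g_M)$ means that, with similar exception, $c\,g_M\le f_M\le C\,g_M$ for some such constants $c,C\in(0,\infty)$. *)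

(* Defs.v *)
From HB Require Import structures.
From mathcomp Require Export all_boot all_order all_algebra.
From mathcomp Require Export complex.
From mathcomp Require Export all_classical all_reals all_analysis.

Set Implicit Arguments.
Unset Strict Implicit.
Unset Printing Implicit Defensive.

Import Order.TTheory GRing.Theory Num.Theory numFieldNormedType.Exports.
Local Open Scope classical_set_scope.
Local Open Scope complex_scope.
Local Open Scope ring_scope.

Section Probability.
Context (R : realType).

Definition mutually_independent (d : measure_display) (T : measurableType d)
    (P : probability T R) (I : finType) (X : I -> {RV P >-> R}) : Prop :=
  forall (J : {set I}) (B : I -> set R), (forall i, measurable (B i)) ->
    P [set w | forall i, i \in J -> B i (X i w)]
      = (\prod_(i in J) P (X i @^-1` B i))%E.

Definition standard_gaussian (d : measure_display) (T : measurableType d)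
    (P : probability T R) (X : {RV P >-> R}) : Prop :=
  forall B : set R, measurable B -> distribution P X B = normal_prob 0 1 B.

Definition iid_standard_gaussian (d : measure_display) (T : measurableType d)
    (P : probability T R) (I : finType) (X : I -> {RV P >-> R}) : Prop :=
  mutually_independent X /\ forall i, standard_gaussian (X i).

End Probability.

Section Landau.
Context (R : realType) (d : nat -> measure_display)
  (T : forall M, measurableType (d M)) (P : forall M, probability (T M) R).

(* [Q M] holds for all large [M] off exceptional events [N M] of vanishing
   probability.  [Q M] itself need not be measurable. *)
Definition with_high_probability (Q : forall M, T M -> Prop) : Prop :=
  exists N : forall M, set (T M),
    [/\ forall M, measurable (N M),
        P M (N M) @[M --> \oo] --> (0 : \bar R)
      & \forall M \near \oo, forall w, ~ N M w -> Q M w].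

Definition prob_bigO (f : forall M, T M -> R) (g : nat -> R) : Prop :=
  exists C : R, with_high_probability (fun M w => `|f M w| <= C * g M).

Definition prob_bigTheta (f : forall M, T M -> R) (g : nat -> R) : Prop :=
  exists c C : R, [/\ 0 < c, 0 < C &
    with_high_probability (fun M w => c * g M <= f M w <= C * g M)].

End Landau.

Section Operators.
Context (R : realType).

(* The real part of the spectrum in C, i.e. the whole spectrum when [A] is
   Hermitian, which is the only case in which it is used. *)
Definition spectrum (n : nat) (A : 'M[R[i]]_n) : set R :=
  [set E | eigenvalue A E%:C].

(* For Hermitian [A] and [0 < n] the spectrum is finite and nonempty, so the
   infimum is a minimum. *)
Definition min_spectrum (n : nat) (A : 'M[R[i]]_n) : R := inf (spectrum A).

Definition ground_state (n : nat) (A : 'M[R[i]]_n) (psi : 'cV[R[i]]_n) : Prop :=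
  psi != 0 /\ A *m psi = (min_spectrum A)%:C *: psi.

(* [normc] is the modulus with values in [R] (rather than in [R[i]]). *)
Definition norm2 (n : nat) (psi : 'cV[R[i]]_n) : R :=
  Num.sqrt (\sum_i ComplexField.Normc.normc (psi i 0) ^+ 2).

Definition norm_infty (n : nat) (psi : 'cV[R[i]]_n) : R :=
  \big[Num.max/0]_i ComplexField.Normc.normc (psi i 0).

(* Meaningful for nonempty bounded sets ([sup] and [inf] are real valued). *)
Definition hausdorff_distance (I J : set R) : R :=
  Num.max (sup [set inf [set `|x - y| | y in J] | x in I])
          (sup [set inf [set `|x - y| | x in I] | y in J]).

Definition kappa (lambda : R) (M : nat) : R :=
  lambda / Num.sqrt (2 * ln (M%:R : R)).

Definition phi0 (M : nat) : 'cV[R[i]]_M := const_mx ((Num.sqrt M%:R)^-1)%:C.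

Definition potential (M : nat) (v : 'I_M -> R) : 'M[R[i]]_M :=
  diag_mx (\row_j (v j)%:C).

Definition scaled_potential (lambda : R) (M : nat) (v : 'I_M -> R) :
    'M[R[i]]_M :=
  (kappa lambda M)%:C *: potential v.

Definition hamiltonian (lambda : R) (M : nat) (v : 'I_M -> R) : 'M[R[i]]_M :=
  - (phi0 M *m map_mx Num.conj (phi0 M)^T) + scaled_potential lambda v.

Definition limit_spectrum (lambda : R) : set R :=
  [set -1] `|` `[- lambda, lambda]%classic.

End Operators.

(* Main.v *)
Require Import Defs.
From mathcomp Require Import ring lra measurable_realfun.
From mathcomp Require Import measurable_fun_approximation.

Set Implicit Arguments.
Unset Strict Implicit.
Unset Printing Implicit Defensive.

Import Order.TTheory GRing.Theory Num.Theory numFieldNormedType.Exports.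
Local Open Scope classical_set_scope.
Local Open Scope ring_scope.

(** Since [phi0] is a unit vector with constant entries, a real [E] below all
    the potential values [u i = kappa V(i)] is an eigenvalue iff the secular
    function [M^-1 \sum_i (u i - E)^-1] equals 1.  It is increasing, so exactly
    one eigenvalue [E0] lies below [min u], and all others lie between [min u]
    and [max u].  Differences of basis vectors are orthogonal to [phi0], so any
    two potential values at distance at most [r] from [m] force an eigenvalue
    at distance at most [r] from [m]; since the [u i] fill [[-lambda, lambda]]
    with high probability, this gives (1).

    For [lambda < 1] the points [- E0] and [u i] stay away from each other, and
    expanding the secular equation in moments of [u], which concentrate around
    the Gaussian ones, yields [E0 = -1 - kappa^2 + O(kappa^4)].  For
    [lambda > 1] let [i0] be the index of the minimum.  The sum
    [M^-1 \sum_(i != i0) (u i - u i0)^-1] is, with high probability, at most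
    some [q < 1]: its bulk part tends to [1 / lambda], and near the edge there
    are few potential values, separated by a negative power of [M] that is small
    enough.  The secular equation then forces [u i0 - E0 <= 1 / (M (1 - q))], so
    that the eigenfunction [i |-> (u i - E0)^-1] is concentrated at [i0]. *)

(** * Approximate eigenvectors *)

(** With [L = sqrt (2 ln M)] one has [M = exp (L ^ 2 / 2)] and [kappa = lambda / L]. A Gaussian tail
    at [c * L] is at most of order [M ^ (- c ^ 2)], so probabilistic estimates become comparisons of
    exponents of [L ^ 2], and every failure probability is brought to the common rate [C / L].

    One residual estimate, [approximate_eigenvalue], is used three times: for differences of basis
    vectors, for an eigenvalue below the potential, and for the stability of the spectrum when the
    potential changes. The last makes the Hausdorff distance Lipschitz in the potential, hence the
    event in (1) measurable.

    The delicate point is the lower edge for [lambda > 1]. With [e = 1 - c ^ 2], at most [M ^ (2 e)]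
    of the Gaussian values lie below [- c * L], and a union bound over pairs keeps them
    [M ^ (- 4 e)] apart. Up to a factor [L] they add at most [M ^ (6 e - 1)] to the secular sum. The
    choice [e <= 1 / 8] makes this vanish and also keeps the gap above [kappa / sqrt M], which the
    bound on the eigenfunction requires. *)

Local Notation normc := ComplexField.Normc.normc.

Section spectral_approximation.
Local Open Scope sesquilinear_scope.
Local Open Scope complex_scope.
Local Open Scope ring_scope.
Context (R : realType) (n : nat).
Implicit Types (A : 'M[R[i]]_n) (psi : 'cV[R[i]]_n).

Lemma normcE (z : R[i]) : (normc z)%:C = `|z|.
Proof. by rewrite normc_def; case: z. Qed.

Definition sqnorm psi : R := \sum_i normc (psi i 0) ^+ 2.

Lemma sqnormE psi : (sqnorm psi)%:C = (psi^t* *m psi) 0 0.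
Proof.
rewrite /sqnorm mxE raddf_sum/=; apply: eq_bigr => i _.
by rewrite !mxE rmorphXn /= normcE normCKC.
Qed.

Lemma sqnorm_unitary (P : 'M[R[i]]_n) psi :
  P \is unitarymx -> sqnorm (P *m psi) = sqnorm psi.
Proof.
move=> uP; have PP : P^t* *m P = 1%:M.
  by rewrite -invmx_unitary // mulVmx // unitarymx_unit.
apply: (@complexI R); rewrite !sqnormE trmx_mul map_mxM /=.
by rewrite -mulmxA (mulmxA _ P) PP mul1mx.
Qed.

(** [eigenvalue] refers to row vectors, [ground_state] to columns; for a symmetric matrix,
    transposition passes from one to the other. *)
Lemma symmetric_eigenvalueP A a : A^T = A ->
  reflect (exists2 psi : 'cV_n, A *m psi = a *: psi & psi != 0)
          (eigenvalue A a).
Proof.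
move=> sA; apply: (iffP eigenvalueP) => -[v vA v0].
  exists v^T; last by rewrite trmx_eq0.
  by rewrite -[in LHS]sA -trmx_mul vA linearZ.
exists v^T; last by rewrite trmx_eq0.
by rewrite -[in LHS]sA -trmx_mul vA linearZ.
Qed.

(** In an orthonormal eigenbasis [A - m] is diagonal. If all eigenvalues were farther than [r] from
    [m], each nonzero coordinate of [psi] would be stretched by more than [r], and the residual
    would be too long. *)
Lemma approximate_eigenvalue A (m r : R) psi :
  A \is hermsymmx -> 0 <= r -> psi != 0 ->
  sqnorm (A *m psi - m%:C *: psi) <= r ^+ 2 * sqnorm psi ->
  exists2 E, spectrum A E & `|E - m| <= r.
Proof.
move=> hA r0 psi0 le.
pose P := spectralmx A; pose D := spectral_diag A.
have uP : P \is unitarymx by exact: spectral_unitarymx.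
have PU : P \in unitmx by exact: unitarymx_unit.
have /orthomx_spectralP AE := hermitian_normalmx hA.
have Dreal k : exists2 e, D 0 k = e%:C & spectrum A e.
  have /mxOverP/(_ 0 k)/complex_realP[e De] := hermitian_spectral_diag_real hA.
  exists e; rewrite // /spectrum /= -De; apply/eigenvalueP; exists (row k P).
    rewrite -/D -/P -row_mul AE !mulmxA mulmxV// mul1mx row_mul.
    by rewrite row_diag_mx -scalemxAl -rowE.
  apply/negP => /eqP rk0.
  have : row k (P *m invmx P) = 0 by rewrite row_mul rk0 mul0mx.
  rewrite mulmxV// => /rowP /(_ k); rewrite !mxE eqxx /= => /eqP.
  by rewrite oner_eq0.
apply: contrapT => no.
pose psi' := P *m psi.
have psi'0 : psi' != 0.
  apply: contra psi0 => /eqP psi'0.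
  by rewrite -[psi](mulKmx PU) -/psi' psi'0 mulmx0.
have: sqnorm (P *m (A *m psi - m%:C *: psi)) <= r ^+ 2 * sqnorm psi'.
  by rewrite /psi' !sqnorm_unitary.
apply/negP; rewrite -ltNge.
have PA : P *m (A *m psi - m%:C *: psi) = diag_mx D *m psi' - m%:C *: psi'.
  have PAD : P *m A = diag_mx D *m P by rewrite AE !mulmxA mulmxV // mul1mx.
  by rewrite mulmxBr -scalemxAr mulmxA PAD -mulmxA.
rewrite PA /sqnorm mulr_sumr.
have ent k : exists2 e, spectrum A e &
    (diag_mx D *m psi' - m%:C *: psi') k 0 = (e - m)%:C * psi' k 0.
  have [e De se] := Dreal k; exists e => //.
  rewrite mxE mul_diag_mx !mxE De -/P -/psi'.
  by rewrite [in RHS]raddfB/= mulrBl.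
(* A nonzero coordinate makes the comparison of the two sums strict. *)
have [k k0] : exists k, psi' k 0 != 0.
  apply: contrapT => h; case/eqP: psi'0; apply/colP => k; rewrite !mxE.
  by apply/eqP; apply: contrapT => /negP hk; apply: h; exists k; rewrite mxE.
have gtr e : spectrum A e -> r < `|e - m|.
  by move=> se; rewrite ltNge; apply/negP => h; apply: no; exists e.
rewrite (bigD1 k) //= [ltRHS](bigD1 k) //= ltr_leD //.
  have [e /gtr se ->] := ent k.
  rewrite ComplexField.Normc.normcM exprMn ltr_pM2r.
    by rewrite /= expr0n /= addr0 sqrtr_sqr ltr_pXn2r // nnegrE.
  rewrite exprn_even_gt0 //=; apply: contra k0 => /eqP.
  by move/ComplexField.Normc.eq0_normc => ->.
apply: ler_sum => j _.
have [e /gtr se ->] := ent j.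
rewrite ComplexField.Normc.normcM exprMn ler_wpM2r ?sqr_ge0 //.
by rewrite /= expr0n /= addr0 sqrtr_sqr lerXn2r ?nnegrE // ltW.
Qed.

End spectral_approximation.

(** * Rank-one perturbations of a diagonal matrix *)

Section mean_field.
Local Open Scope complex_scope.
Local Open Scope ring_scope.
Context (R : realType) (M : nat).
Implicit Types (u : 'I_M -> R) (psi : 'cV[R[i]]_M).

Lemma sum_eqr i : \sum_(k < M) (k == i)%:R = 1 :> R.
Proof.
rewrite (bigD1 i) //= eqxx big1 ?addr0 // => k /negPf ->; exact: mulr0n.
Qed.

(** The coupling is absorbed into [u], which keeps the deterministic part free of [lambda] and of
    the normalization of [kappa]. *)
Definition mean_field u : 'M[R[i]]_M :=
  - (phi0 R M *m map_mx Num.conj (phi0 R M)^T) + potential u.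

Lemma hamiltonianE lambda (v : 'I_M -> R) :
  hamiltonian lambda v = mean_field (fun i => kappa lambda M * v i).
Proof.
congr (_ + _); apply/matrixP => i j; rewrite !mxE.
by rewrite mulrnAr -(rmorphM (real_complex R)).
Qed.

Lemma scaled_potentialE lambda (v : 'I_M -> R) :
  scaled_potential lambda v = potential (fun i => kappa lambda M * v i).
Proof.
apply/matrixP => i j; rewrite !mxE.
by rewrite mulrnAr -(rmorphM (real_complex R)).
Qed.

Lemma rank_oneE i j :
  (phi0 R M *m map_mx Num.conj (phi0 R M)^T) i j = (M%:R^-1)%:C.
Proof.
rewrite mxE big_ord1 !mxE conj_Creal; last by apply/complex_realP; eexists.
by rewrite -(rmorphM (real_complex R)) /= -invfM -expr2 sqr_sqrtr ?ler0n.
Qed.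

Lemma mean_field_mulE u psi i :
  (mean_field u *m psi) i 0 =
  (u i)%:C * psi i 0 - (M%:R^-1)%:C * \sum_j psi j 0.
Proof.
rewrite mulmxDl mxE addrC mul_diag_mx !mxE; congr (_ + _).
rewrite mulr_sumr -sumrN; apply: eq_bigr => j _.
by rewrite [X in X * _ = _]mxE rank_oneE mulNr.
Qed.

Lemma mean_fieldE u i j : mean_field u i j = (u i *+ (i == j) - M%:R^-1)%:C.
Proof.
rewrite mxE [(- _ : 'M[_]_(_, _)) _ _]mxE rank_oneE !mxE addrC rmorphB /=.
by rewrite (rmorphMn (real_complex R)).
Qed.

Lemma mean_field_sym u : (mean_field u)^T = mean_field u.
Proof.
by apply/matrixP => i j; rewrite mxE !mean_fieldE eq_sym; case: eqP => // ->.
Qed.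

Lemma mean_field_herm u : mean_field u \is hermsymmx.
Proof.
apply/is_hermitianmxP; rewrite expr0 scale1r.
apply/matrixP => i j; rewrite [RHS]mxE mean_field_sym mean_fieldE.
by rewrite conj_Creal //; apply/complex_realP; eexists.
Qed.

Lemma spectrum_mean_fieldP u E :
  spectrum (mean_field u) E <->
  exists2 psi : 'cV_M, mean_field u *m psi = E%:C *: psi & psi != 0.
Proof.
by split => [/(symmetric_eigenvalueP _ (mean_field_sym u))|h] //;
  apply/(symmetric_eigenvalueP _ (mean_field_sym u)).
Qed.

Lemma mean_field_residualE u psi E i :
  (mean_field u *m psi - E%:C *: psi) i 0 =
  (u i - E)%:C * psi i 0 - (M%:R^-1)%:C * \sum_j psi j 0.
Proof.
rewrite -scaleN1r scalerA [LHS]mxE mean_field_mulE [X in _ + X = _]mxE.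
by rewrite (rmorphB (real_complex R)) mulrBl mulN1r mulNr addrAC.
Qed.

(** The rank-one part sends [psi] to a constant vector; away from the potential values, [u i - E]
    can be divided out. *)
Lemma mean_field_eigenvectorP u psi (E : R) : (forall i, u i != E) ->
  mean_field u *m psi = E%:C *: psi ->
  exists alpha, forall i, psi i 0 = alpha * ((u i - E)^-1)%:C.
Proof.
move=> uE /colP Hpsi; exists ((M%:R^-1)%:C * \sum_j psi j 0) => i.
have := Hpsi i; rewrite mean_field_mulE mxE => /eqP.
rewrite subr_eq addrC -subr_eq -mulrBl -(rmorphB (real_complex R)) => /eqP <-.
rewrite mulrAC -rmorphM /= divff ?mul1r // subr_eq0; exact: uE.
Qed.

Definition secular u E : R := M%:R^-1 * \sum_i (u i - E)^-1.

(** The factor [alpha] of an eigenvector is the mean of its own entries; this self-consistency is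
    the secular equation. *)
Lemma secular_eq1P u E : (forall i, u i != E) ->
  spectrum (mean_field u) E <-> secular u E = 1.
Proof.
move=> uE; rewrite spectrum_mean_fieldP; split => [[psi Hpsi psi0]|F1].
  have [alpha ha] := mean_field_eigenvectorP uE Hpsi.
  have alpha0 : alpha != 0.
    apply: contra psi0 => /eqP a0; apply/eqP/colP => i.
    by rewrite ha a0 mul0r mxE.
  have [i _] : exists i : 'I_M, true.
    apply: contrapT => h; move/eqP: psi0; apply; apply/colP => i.
    by exfalso; apply: h; exists i.
  have := congr1 (fun A : 'cV_M => A i 0) Hpsi.
  rewrite mean_field_mulE mxE => /eqP.
  rewrite subr_eq addrC -subr_eq -mulrBl -(rmorphB (real_complex R)).
  rewrite ha mulrCA -rmorphM /= mulfV ?subr_eq0 // mulr1.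
  under eq_bigr do rewrite ha.
  rewrite -mulr_sumr mulrCA -{1}[alpha]mulr1 => /eqP /(mulfI alpha0).
  by rewrite -rmorph_sum -rmorphM /= => -[->].
exists (\col_i ((u i - E)^-1)%:C).
  apply/colP => i; rewrite mean_field_mulE !mxE.
  under eq_bigr do rewrite mxE.
  rewrite -rmorph_sum -!rmorphM -rmorphB /= -[_ * \sum_i _]/(secular u E) F1.
  congr (_ %:C); have := uE i; rewrite -subr_eq0 => h; field.
  exact: h.
apply/eqP => /colP h.
have : secular u E = 0.
  rewrite /secular big1 ?mulr0 // => i _; apply: (@complexI R).
  by have := h i; rewrite !mxE.
by rewrite F1 => /eqP; rewrite oner_eq0.
Qed.

Lemma secular_homo u E E' : (0 < M)%N -> (forall i, E' < u i) -> E < E' ->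
  secular u E < secular u E'.
Proof.
move=> M0 uE EE'; rewrite ltr_pM2l ?invr_gt0 ?ltr0n //.
apply: ltr_sum => [|i _]; first by apply/hasP; exists (Ordinal M0); rewrite ?mem_index_enum.
by have := uE i => h; rewrite ltf_pV2 ?posrE; lra.
Qed.

(* [e_i - e_j] is orthogonal to [phi0], so the rank-one part does not see it. *)
Lemma mean_field_pair u i j (m r : R) : i != j ->
  `|u i - m| <= r -> `|u j - m| <= r ->
  exists2 E, spectrum (mean_field u) E & `|E - m| <= r.
Proof.
move=> ij ui uj; have r0 : 0 <= r := le_trans (normr_ge0 _) ui.
pose psi : 'cV[R[i]]_M := delta_mx i 0 - delta_mx j 0.
have psiE k : psi k 0 = ((k == i)%:R - (k == j)%:R)%:C.
  by rewrite !mxE !andbT rmorphB /= !rmorph_nat.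
apply: (@approximate_eigenvalue _ _ _ _ _ psi) => //; first exact: mean_field_herm.
  apply/eqP => /colP /(_ i) /eqP; rewrite psiE mxE eqxx (negPf ij) subr0.
  by rewrite oner_eq0.
rewrite /sqnorm mulr_sumr; apply: ler_sum => k _.
have s0 : \sum_j psi j 0 = 0.
  under eq_bigr do rewrite psiE.
  rewrite -rmorph_sum /= sumrB !sum_eqr subrr //.
rewrite mean_field_residualE s0 mulr0 subr0.
rewrite ComplexField.Normc.normcM exprMn.
have [ki|ki] := eqVneq k i; last have [kj|kj] := eqVneq k j.
- rewrite ler_wpM2r ?sqr_ge0 // /= expr0n /= addr0 sqrtr_sqr ki.
  by rewrite lerXn2r ?nnegrE.
- rewrite ler_wpM2r ?sqr_ge0 // /= expr0n /= addr0 sqrtr_sqr kj.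
  by rewrite lerXn2r ?nnegrE.
- rewrite psiE (negPf ki) (negPf kj) subr0.
  by rewrite ComplexField.Normc.normc0 expr0n /= !mulr0.
Qed.

(** An eigenvector for [u] is an approximate one for [u'], with residual [(u' - u) psi]. The
    measurability of the event in (1) rests on this. *)
Lemma mean_field_shift u u' E (r : R) : (forall i, `|u i - u' i| <= r) -> 0 <= r ->
  spectrum (mean_field u) E ->
  exists2 E', spectrum (mean_field u') E' & `|E' - E| <= r.
Proof.
move=> uu' r0 /spectrum_mean_fieldP[psi /colP Hpsi psi0].
apply: (approximate_eigenvalue (mean_field_herm u') r0 psi0).
rewrite /sqnorm mulr_sumr; apply: ler_sum => k _.
have := Hpsi k; rewrite mean_field_mulE mxE => Hk.
rewrite mean_field_residualE.
rewrite [X in normc X](_ : _ = (u' k - u k)%:C * psi k 0); last first.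
  move: Hk => /eqP; rewrite subr_eq addrC -subr_eq => /eqP <-.
  by rewrite !(rmorphB (real_complex R)); ring.
rewrite ComplexField.Normc.normcM exprMn ler_wpM2r ?sqr_ge0 //.
rewrite /= expr0n /= addr0 sqrtr_sqr distrC.
by rewrite lerXn2r ?nnegrE ?uu'.
Qed.

(* With [u i - 1] as approximate eigenvalue, the unit vector [e_i] leaves a
   residual of squared norm [1 - M^-1 < 1]. *)
Lemma exists_eigenvalue_lt u i : exists2 E, spectrum (mean_field u) E & E < u i.
Proof.
have M0 : (0 < M)%N by case: (M) i => [[]|].
have Mi0 : 0 < M%:R^-1 :> R by rewrite invr_gt0 ltr0n.
have Mi1 : M%:R^-1 <= 1 :> R by rewrite invf_le1 ?ltr0n // ler1n.
pose r : R := Num.sqrt (1 - M%:R^-1).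
have r2 : r ^+ 2 = 1 - M%:R^-1 by rewrite sqr_sqrtr // subr_ge0.
have r0 : 0 <= r by exact: sqrtr_ge0.
have r1 : r < 1 by rewrite -(ltr_pXn2r (_ : 0 < 2)%N) ?nnegrE // r2; lra.
suff [E sE En] : exists2 E, spectrum (mean_field u) E & `|E - (u i - 1)| <= r.
  by exists E => //; move: En; rewrite ler_norml => /andP[]; lra.
pose psi : 'cV[R[i]]_M := delta_mx i 0.
apply: (@approximate_eigenvalue _ _ _ _ _ psi) => //.
- exact: mean_field_herm.
- apply/eqP => /colP /(_ i) /eqP; by rewrite !mxE !eqxx oner_eq0.
have dE k : psi k 0 = ((k == i)%:R : R)%:C :> R[i].
  by rewrite mxE andbT rmorph_nat.
have s1 : \sum_(j < M) psi j 0 = 1.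
  under eq_bigr do rewrite dE.
  by rewrite -rmorph_sum /= sum_eqr.
have normcR (x : R) : normc x%:C ^+ 2 = x ^+ 2.
  by rewrite /= expr0n /= addr0 sqrtr_sqr real_normK ?num_real.
rewrite /sqnorm r2.
have -> : \sum_k normc (psi k 0) ^+ 2 = 1.
  under eq_bigr do rewrite dE normcR.
  rewrite -[RHS](sum_eqr i); apply: eq_bigr => k _.
  by case: eqP => _; rewrite ?expr1n // expr0n.
rewrite mulr1.
under eq_bigr => k _.
  rewrite mean_field_residualE s1 mulr1 dE -(rmorphM (real_complex R)).
  rewrite -(rmorphB (real_complex R)) normcR.
  (* The residual has the entries [(k == i) - M^-1], and the indicator is its own square. *)
  rewrite (_ : _ ^+ 2 = (k == i)%:R * (1 - M%:R^-1 *+ 2) + M%:R^-1 ^+ 2); last first.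
    by case: eqP => [->|_] /=; ring.
  over.
rewrite big_split /= -mulr_suml sum_eqr mul1r sumr_const card_ord.
rewrite (_ : M%:R^-1 ^+ 2 *+ M = M%:R^-1 :> R); first by lra.
by rewrite -mulr_natr expr2 mulfVK // pnatr_eq0 -lt0n.
Qed.

End mean_field.

(** * The lowest eigenvalue *)

Section ground_state_energy.
Local Open Scope complex_scope.
Local Open Scope ring_scope.
Context (R : realType) (M : nat) (M0 : (0 < M)%N).
Implicit Types (u : 'I_M -> R) (psi : 'cV[R[i]]_M).

Lemma exists_argmin u : exists i, forall j, u i <= u j.
Proof.
have [i _ h] := @arg_minP _ _ _ (Ordinal M0) xpredT u isT.
by exists i => j; exact: h.
Qed.

(** Existence comes from [exists_eigenvalue_lt] at the argmin, minimality from the strict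
    monotonicity of [secular]. *)
Lemma exists_ground_energy u : exists2 E, spectrum (mean_field u) E &
  (forall i, E < u i) /\ (forall E', spectrum (mean_field u) E' -> E <= E').
Proof.
have [i ui] := exists_argmin u.
have [E sE Ei] := exists_eigenvalue_lt u i.
have Eu j : E < u j by exact: lt_le_trans (ui j).
exists E => //; split=> // E' sE'; rewrite leNgt; apply/negP => E'E.
have E'u j : E' < u j by exact: lt_trans (Eu j).
have := secular_homo M0 Eu E'E.
move/secular_eq1P: sE => ->; last by move=> j; rewrite gt_eqF.
by move/secular_eq1P: sE' => ->; [rewrite ltxx | move=> j; rewrite gt_eqF].
Qed.

Lemma min_spectrumE u E : spectrum (mean_field u) E ->
  (forall E', spectrum (mean_field u) E' -> E <= E') ->
  min_spectrum (mean_field u) = E.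
Proof.
move=> sE lE; apply/eqP; rewrite eq_le; apply/andP; split.
  by apply: ge_inf => //; exists E.
by apply: lb_le_inf; [exists E|].
Qed.

Lemma min_spectrum_spectrum u :
  spectrum (mean_field u) (min_spectrum (mean_field u)).
Proof. by have [E sE [_ lE]] := exists_ground_energy u; rewrite (min_spectrumE sE lE). Qed.

Lemma min_spectrum_lt u i : min_spectrum (mean_field u) < u i.
Proof.
by have [E sE [Eu lE]] := exists_ground_energy u; rewrite (min_spectrumE sE lE).
Qed.

Lemma secular_min_spectrum u : secular u (min_spectrum (mean_field u)) = 1.
Proof.
apply/secular_eq1P; first by move=> i; rewrite gt_eqF // min_spectrum_lt.
exact: min_spectrum_spectrum.
Qed.

Lemma min_spectrum_unique u E : spectrum (mean_field u) E ->
  (forall i, E < u i) -> E = min_spectrum (mean_field u).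
Proof.
move=> /secular_eq1P sE Eu; have := sE (fun i => negbT (gt_eqF (Eu i))).
have mu := min_spectrum_lt u.
have := secular_min_spectrum u; set E0 := min_spectrum _ in mu *.
move=> F0 F1; have [h|h|//] := ltgtP E E0.
  by have := secular_homo M0 mu h; rewrite F0 F1 ltxx.
by have := secular_homo M0 Eu h; rewrite F0 F1 ltxx.
Qed.

Lemma secular_le_const u E c : (forall i, (u i - E)^-1 <= c) -> secular u E <= c.
Proof.
move=> h; rewrite ler_pdivrMl ?ltr0n //.
apply: le_trans (ler_sum _ (fun i _ => h i)) _.
by rewrite sumr_const card_ord mulr_natl.
Qed.

(** Above all potential values every summand of [secular] is negative, so it cannot be 1; below all
    of them only the ground energy is left. *)
Lemma spectrum_mean_field_sub u a b E : (forall i, a <= u i <= b) ->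
  spectrum (mean_field u) E -> E = min_spectrum (mean_field u) \/ a <= E <= b.
Proof.
move=> uab sE; have [bE|Eb] := ltP b E.
  exfalso; have uE i : u i < E by have := uab i; lra.
  have : secular u E <= 0.
    by apply: secular_le_const => i; rewrite invr_le0 subr_le0 ltW.
  move/secular_eq1P: sE => ->; first by rewrite ler10.
  by move=> i; rewrite lt_eqF.
have [h|h] := pselect (forall i, E < u i).
  by left; exact: min_spectrum_unique.
move/existsNP: h => [i /negP]; rewrite -leNgt => ui.
by right; have := uab i; lra.
Qed.

(** For a lower ground energy every summand of [secular] would be less than 1. In terms of
    operators, the rank-one part is at least [- 1]. *)
Lemma min_spectrum_ge u a : (forall i, a <= u i) ->
  a - 1 <= min_spectrum (mean_field u).
Proof.
move=> au; have [i ui] := exists_argmin u.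
set E := min_spectrum _; rewrite leNgt; apply/negP => Ea.
have : secular u E <= (u i - E)^-1.
  apply: secular_le_const => j; have := min_spectrum_lt u i.
  have := ui j; rewrite -/E => h1 h2.
  by rewrite lef_pV2 ?posrE; lra.
rewrite secular_min_spectrum leNgt invf_lt1.
  by have := au i; have := min_spectrum_lt u i; rewrite -/E; lra.
by have := au i; have := min_spectrum_lt u i; rewrite -/E; lra.
Qed.

(** The right-hand side is the Rayleigh quotient of [phi0]. The proof replaces each convex summand
    of [secular] by its tangent at distance 1. *)
Lemma min_spectrum_le_mean u :
  min_spectrum (mean_field u) <= -1 + M%:R^-1 * \sum_i u i.
Proof.
have := secular_min_spectrum u; have := min_spectrum_lt u.
set E := min_spectrum _ => Eu F1.
suff : 2 + E - M%:R^-1 * \sum_i u i <= 1 by lra.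
rewrite -[leRHS]F1 /secular.
have -> : 2 + E - M%:R^-1 * \sum_i u i = M%:R^-1 * \sum_i (2 + E - u i).
  rewrite sumrB mulrBr sumr_const card_ord -[(2 + E) *+ M]mulr_natl mulKf // pnatr_eq0.
  by rewrite -lt0n.
rewrite ler_pM2l ?invr_gt0 ?ltr0n //; apply: ler_sum => i _.
have x0 : 0 < u i - E by rewrite subr_gt0.
(* [2 - x <= x^-1] for [x > 0] *)
rewrite -(ler_pM2l x0) mulfV ?gt_eqF //.
have := sqr_ge0 (u i - E - 1); nra.
Qed.

Lemma min_spectrum_potential u i : (forall j, u i <= u j) ->
  min_spectrum (potential u) = u i.
Proof.
move=> ui; rewrite /min_spectrum; suff -> : spectrum (potential u) = range u.
  apply/eqP; rewrite eq_le; apply/andP; split.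
    by apply: ge_inf; [exists (u i) => _ [j _ <-] | exists i].
  by apply: lb_le_inf; [exists (u i); exists i | move=> _ [j _ <-]].
apply/seteqP; split => [E /symmetric_eigenvalueP []|_ [j _ <-]].
- exact: tr_diag_mx.
- move=> psi /colP h psi0; apply: contrapT => no; case/eqP: psi0.
  apply/colP => j; have := h j.
  rewrite mul_diag_mx !mxE => /eqP; rewrite -subr_eq0 -mulrBl mulf_eq0.
  case/orP => [|/eqP->//]; rewrite -(rmorphB (real_complex R)) => /eqP [] /eqP.
  by rewrite subr_eq0 => /eqP ujE; exfalso; apply: no; exists j.
- apply/symmetric_eigenvalueP; first exact: tr_diag_mx.
  exists (delta_mx j 0).
    apply/colP => k; rewrite mul_diag_mx !mxE andbT.
    by case: eqP => [->|]; rewrite ?mulr0.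
  by apply/eqP => /colP /(_ j) /eqP; rewrite !mxE !eqxx oner_eq0.
Qed.

End ground_state_energy.

(** * Shape of the ground state *)

Section ground_state_profile.
Context (R : realType) (M : nat).
Implicit Types (u : 'I_M -> R) (psi : 'cV[R[i]]_M).

(** The entries of [psi] are proportional to [(u i - E)^-1], which is positive and largest at [i0];
    the factor cancels in the ratio. *)
Lemma ground_state_ratioE u psi i0 : (forall j, u i0 <= u j) ->
  ground_state (mean_field u) psi ->
  let E := min_spectrum (mean_field u) in
  norm2 psi / norm_infty psi = Num.sqrt (\sum_i ((u i0 - E) / (u i - E)) ^+ 2).
Proof.
move=> ui [psi0 Hpsi] E.
have M0 : (0 < M)%N := leq_ltn_trans (leq0n i0) (ltn_ord i0).
have Eu i : E < u i by exact: min_spectrum_lt.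
have [|alpha ha] := mean_field_eigenvectorP _ Hpsi.
  by move=> i; rewrite gt_eqF.
have x0 i : 0 < (u i - E)^-1 by rewrite invr_gt0 subr_gt0.
have nE i : normc (psi i 0) = normc alpha * (u i - E)^-1.
  rewrite ha ComplexField.Normc.normcM /= expr0n /= addr0 sqrtr_sqr.
  by rewrite gtr0_norm.
have a0 : 0 < normc alpha.
  rewrite lt_neqAle eq_sym; apply/andP; split; last by case: (alpha) => a b /=.
  apply: contra psi0 => /eqP/ComplexField.Normc.eq0_normc a0.
  by apply/eqP/colP => i; rewrite ha a0 mul0r mxE.
have -> : norm_infty psi = normc alpha * (u i0 - E)^-1.
  rewrite /norm_infty -nE; apply/eqP; rewrite eq_le; apply/andP; split.
    apply/bigmax_leP; split; first by rewrite nE mulr_ge0 ?ltW.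
    move=> i _; rewrite !nE ler_pM2l // lef_pV2 ?posrE ?subr_gt0 //.
    by rewrite lerD2r.
  exact: (le_bigmax _ (fun i => normc (psi i 0)) i0).
have -> : norm2 psi = normc alpha * Num.sqrt (\sum_i (u i - E)^-1 ^+ 2).
  rewrite /norm2; under eq_bigr do rewrite nE exprMn.
  by rewrite -mulr_sumr sqrtrM ?sqr_ge0 // sqrtr_sqr gtr0_norm.
rewrite invfM invrK mulrACA mulfV ?gt_eqF // mul1r mulrC.
under [in RHS]eq_bigr do rewrite exprMn.
rewrite -mulr_sumr sqrtrM ?sqr_ge0 // sqrtr_sqr ger0_norm //.
by rewrite subr_ge0 ltW.
Qed.

(** In the secular equation, the terms other than [i0] grow when [E] is replaced by the larger
    [u i0]. They contribute at most [q], so the single term at [i0] must supply [1 - q]. *)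
Lemma localized_energy u i0 (q : R) : q < 1 -> (forall i, i != i0 -> u i0 < u i) ->
  M%:R^-1 * \sum_(i | i != i0) (u i - u i0)^-1 <= q ->
  u i0 - min_spectrum (mean_field u) <= (M%:R * (1 - q))^-1.
Proof.
move=> q1 ui S; have M0 : (0 < M)%N := leq_ltn_trans (leq0n i0) (ltn_ord i0).
have M0' : 0 < M%:R :> R by rewrite ltr0n.
have Eu i := min_spectrum_lt M0 u i; have := secular_min_spectrum M0 u.
set E := min_spectrum _ in Eu *; rewrite /secular (bigD1 i0) //= mulrDr => F1.
have : M%:R^-1 * \sum_(i | i != i0) (u i - E)^-1 <= q.
  apply: le_trans S; rewrite ler_pM2l ?invr_gt0 //; apply: ler_sum => i ii0.
  have := ui i ii0; have := Eu i0 => h1 h2.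
  by rewrite lef_pV2 ?posrE; lra.
have x0 : 0 < u i0 - E by rewrite subr_gt0.
move=> S'; have : 1 - q <= M%:R^-1 * (u i0 - E)^-1 by lra.
by rewrite -invfM -[leLHS]invrK lef_pV2 ?posrE ?invr_gt0 ?subr_gt0 ?mulr_gt0 // => h;
  rewrite invfM ler_pdivlMl.
Qed.

(** Off [i0], one factor [(u i - E)^-1] of the square is bounded by [g^-1], the other is summed by
    the hypothesis on [q], and [localized_energy] bounds the common factor [(u i0 - E) ^ 2]. *)
Lemma localized_ratio u psi i0 (q g : R) : q < 1 -> 0 < g ->
  (forall i, i != i0 -> u i0 + g <= u i) ->
  M%:R^-1 * \sum_(i | i != i0) (u i - u i0)^-1 <= q ->
  ground_state (mean_field u) psi ->
  1 <= norm2 psi / norm_infty psi <= 1 + q / (1 - q) ^+ 2 / (M%:R * g).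
Proof.
move=> q1 g0 ui S gs; have M0 : (0 < M)%N := leq_ltn_trans (leq0n i0) (ltn_ord i0).
have M0' : 0 < M%:R :> R by rewrite ltr0n.
have ui' i : i != i0 -> u i0 < u i by move=> /ui; apply: lt_le_trans; rewrite ltrDl.
have ui0 i : u i0 <= u i by have [->//|/ui'/ltW] := eqVneq i i0.
have e1 := localized_energy q1 ui' S.
rewrite (ground_state_ratioE ui0 gs).
have Eu := min_spectrum_lt M0 u; set E := min_spectrum _ in e1 Eu *.
have x0 : 0 < u i0 - E by rewrite subr_gt0.
rewrite (bigD1 i0) //= divff ?gt_eqF // expr1n.
set T := \sum_(i | _) _.
have T0 : 0 <= T by apply: sumr_ge0 => i _; exact: sqr_ge0.
have r1 : 1 <= Num.sqrt (1 + T) by rewrite -{1}sqrtr1 ler_wsqrtr // lerDl.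
rewrite r1 /=; apply: (@le_trans _ _ (1 + T)).
  have := sqr_sqrtr (_ : 0 <= 1 + T); nra.
rewrite lerD2l.
have : T <= (M%:R * (1 - q))^-1 ^+ 2 * (g^-1 * \sum_(i | i != i0) (u i - u i0)^-1).
  rewrite mulr_sumr mulr_sumr; apply: ler_sum => i ii0.
  have := ui i ii0 => ug; have ud : 0 < u i - u i0 by lra.
  have uE : 0 < u i - E by have := Eu i; lra.
  rewrite exprMn ler_pM ?sqr_ge0 //.
    by rewrite lerXn2r ?nnegrE ?(ltW x0) // (le_trans (ltW x0) e1).
  rewrite expr2 ler_pM ?invr_ge0 ?(ltW uE) // lef_pV2 ?posrE //; lra.
move/le_trans; apply.
have q0 : 0 <= q.
  apply: le_trans S; apply: mulr_ge0; rewrite ?invr_ge0 ?(ltW M0') //.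
  by apply: sumr_ge0 => i /ui' h; rewrite invr_ge0 subr_ge0 ltW.
have : (M%:R * (1 - q))^-1 ^+ 2 *
    (g^-1 * (M%:R * (M%:R^-1 * \sum_(i | i != i0) (u i - u i0)^-1)))
  <= (M%:R * (1 - q))^-1 ^+ 2 * (g^-1 * (M%:R * q)).
  by rewrite !ler_wpM2l ?sqr_ge0 ?invr_ge0 ?(ltW g0) ?(ltW M0').
rewrite [M%:R * (M%:R^-1 * _)]mulVKf ?gt_eqF // => /le_trans; apply.
rewrite le_eqVlt; apply/orP; left; apply/eqP; field.
by rewrite !gt_eqF // subr_gt0.
Qed.

(** All entries [(u i - E)^-1] lie between [b^-1] and [rho^-1], so each of the [M] summands in
    [ground_state_ratioE] lies between [(rho / b) ^ 2] and 1. *)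
Lemma delocalized_ratio u psi (rho b : R) : (0 < M)%N -> 0 < rho ->
  (forall i, rho <= u i - min_spectrum (mean_field u) <= b) ->
  ground_state (mean_field u) psi ->
  rho / b * Num.sqrt M%:R <= norm2 psi / norm_infty psi <= Num.sqrt M%:R.
Proof.
move=> M0 rho0 ub gs; have [i0 ui0] := exists_argmin M0 u.
rewrite (ground_state_ratioE ui0 gs); set E := min_spectrum _ in ub *.
have b0 : 0 < b by have := ub i0; lra.
have rb : 0 <= rho / b by rewrite divr_ge0 ?ltW.
apply/andP; split; last first.
  rewrite ler_wsqrtr // -[M in leRHS]card_ord -sum1_card natr_sum ler_sum // => i _.
  have := ub i => hi; have := ub i0 => hi0; have := ui0 i => h.
  by rewrite exprn_ile1 // ?divr_ge0 ?ler_pdivrMr ?mul1r; lra.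
rewrite -[rho / b]ger0_norm // -sqrtr_sqr -sqrtrM ?sqr_ge0 //.
rewrite ler_wsqrtr // mulr_natr -[M in leLHS]card_ord -sumr_const ler_sum // => i _.
have := ub i => hi; have := ub i0 => hi0.
rewrite lerXn2r ?nnegrE ?divr_ge0 //; try lra.
rewrite ler_pM ?invr_ge0 ?(ltW b0) ?(ltW rho0) //; try lra.
by rewrite lef_pV2 ?posrE; lra.
Qed.

End ground_state_profile.

(* With [s = - E0], the averages [y n] of [u^n / (u + s)] satisfy
   [s y_n = m_n - y_(n+1)], where [m_n] is the [n]-th moment of [u] and
   [y_0 = 1].  Unrolling gives [s^2 (s - 1) = m_2 - s m_1 - y_3], up to
   [C1 k^4] equal to [k^2]; passing from [s^2 (s - 1)] to [s - 1] costs
   [(s - 1)^2 (s + 1)], the remaining summand. *)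
Definition perturbation_constant (R : realType) (b C : R) : R :=
  let C1 := 5 + 2 * (C / ((1 - b) / 2)) in C1 + 48 * (1 + C1) ^+ 2.

(** * Ground energy from moments and counts of the potential *)

Section energy_bounds.
Context (R : realType) (M : nat) (M0 : (0 < M)%N).
Implicit Types (u : 'I_M -> R).

Let M0' : 0 < M%:R :> R. Proof. by rewrite ltr0n. Qed.

Lemma min_spectrum_perturbative u (b C k : R) : 0 <= b -> b < 1 -> 0 <= C ->
  0 <= k -> k <= 1 -> k ^+ 4 <= (1 - b) / 2 ->
  (forall i, `|u i| <= b) ->
  `|M%:R^-1 * \sum_i u i| <= k ^+ 4 ->
  `|M%:R^-1 * (\sum_i u i ^+ 2) - k ^+ 2| <= k ^+ 4 ->
  `|M%:R^-1 * \sum_i u i ^+ 3| <= k ^+ 4 ->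
  M%:R^-1 * \sum_i u i ^+ 4 <= C * k ^+ 4 ->
  `|min_spectrum (mean_field u) - (- 1 - k ^+ 2)|
    <= perturbation_constant b C * k ^+ 4.
Proof.
move=> b0 b1 C0 k0 k1 k4 ub m1 m2 m3 m4; rewrite /perturbation_constant.
set rho := (1 - b) / 2.
have rho0 : 0 < rho by rewrite /rho; lra.
set C1 := 5 + 2 * (C / rho).
have C10 : 5 <= C1 by rewrite lerDl mulr_ge0 // divr_ge0 // ltW.
have Eu := min_spectrum_lt M0 u.
have E1 := min_spectrum_le_mean M0 u.
have E2 : - b - 1 <= min_spectrum (mean_field u).
  by apply: min_spectrum_ge => // i; have := ub i; rewrite ler_norml => /andP[].
have := secular_min_spectrum M0 u; rewrite /secular.
pose s := - min_spectrum (mean_field u).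
rewrite (_ : min_spectrum _ = - s) in E1 E2 Eu *; last by rewrite opprK.
pose y (n : nat) := M%:R^-1 * \sum_i u i ^+ n / (u i + s).
pose m (n : nat) := M%:R^-1 * \sum_i u i ^+ n.
move=> y0.
have {}y0 : y 0%N = 1.
  rewrite -y0 /y; under eq_bigr do rewrite expr0 mul1r.
  by under [in RHS]eq_bigr do rewrite opprK.
have us i : 0 < u i + s by have := Eu i; lra.
have step n : s * y n = m n - y n.+1.
  rewrite /y /m -mulrBr -sumrB mulrCA mulr_sumr; congr (_ * _).
  apply: eq_bigr => i _; rewrite exprS; have := us i => h.
  by field; rewrite gt_eqF.
have m0 : m 0%N = 1.
  rewrite /m; under eq_bigr do rewrite expr0.
  by rewrite sumr_const card_ord mulVf // gt_eqF.
(* The trial vector [phi0] gives a ground energy of at most [- 1 + k ^ 4], and [k ^ 4 <= rho]. As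
   [rho] is half of [1 - b], all [u i + s] stay above [rho]. *)
have s1 : 1 - rho <= s.
  by have := le_trans (ler_norm _) m1; rewrite /rho; lra.
have sb : rho <= s - b by move: s1; rewrite /rho; lra.
have usr i : rho <= u i + s by have := ub i; rewrite ler_norml => /andP[]; lra.
have y4 : 0 <= y 4%N.
  apply: mulr_ge0; first by rewrite invr_ge0 ltW.
  apply: sumr_ge0 => i _.
  by rewrite divr_ge0 ?(ltW (us i)) // exprn_even_ge0.
have y4' : y 4%N <= C / rho * k ^+ 4.
  apply: (@le_trans _ _ (rho^-1 * m 4%N)); last first.
    by rewrite [C / rho]mulrC -mulrA ler_pM2l ?invr_gt0.
  rewrite mulrCA ler_pM2l ?invr_gt0 // mulr_sumr ler_sum // => i _.
  rewrite mulrC ler_wpM2r ?exprn_even_ge0 //.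
  by rewrite lef_pV2 ?posrE.
have e0 := step 0%N; have e1 := step 1%N; have e2 := step 2%N; have e3 := step 3%N.
rewrite y0 m0 mulr1 in e0.
rewrite -/(m 3%N) in m3; rewrite -/(m 2%N) in m2.
have m1' : `|m 1%N| <= k ^+ 4.
  by rewrite /m; under eq_bigr do rewrite expr1.
move: m1' m2 m3; rewrite !ler_norml => /andP[m1a m1b] /andP[m2a m2b] /andP[m3a m3b].
have s12 : 1 / 2 <= s by move: s1; rewrite /rho; lra.
have s2 : s <= 2 by lra.
have cr : 0 <= C / rho by rewrite divr_ge0 // ltW.
have k40 : 0 <= k ^+ 4 by exact: exprn_ge0.
set c := C / rho in cr y4' C1 C10 *.
set K := k ^+ 4 in m1a m1b m2a m2b m3a m3b y4' k40 k4 *.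
set Y1 := y 1%N in e0 e1 *; set Y2 := y 2%N in e1 e2 *; set Y3 := y 3%N in e2 e3 *.
set Y4 := y 4%N in y4 y4' e3 *.
have y3a : - (2 * (1 + c) * K) <= Y3 by clear -e3 m3a y4' y4 s12 cr k40; nra.
have y3b : Y3 <= 2 * (1 + c) * K by clear -e3 m3b y4' y4 s12 cr k40; nra.
have main : s ^+ 2 * (s - 1) = - s * m 1%N + m 2%N - Y3.
  have -> : s - 1 = - Y1 by lra.
  rewrite expr2 mulrN -mulrA e1 -/Y2 mulrBr e2; ring.
have k20 : 0 <= k ^+ 2 by exact: exprn_ge0.
have kK : K <= k ^+ 2 by rewrite /K (exprD k 2 2) ler_piMl // exprn_ile1.
have Kk : K = k ^+ 2 * k ^+ 2 by rewrite /K -exprD.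
set k2 := k ^+ 2 in k20 kK Kk main m2a m2b *.
have sK : s * K <= 2 * K by rewrite ler_wpM2r.
have s0 : 0 <= s by lra.
have sma : - (2 * K) <= s * m 1%N.
  by rewrite (le_trans _ (ler_wpM2l s0 m1a)) // mulrN lerN2.
have smb : s * m 1%N <= 2 * K by rewrite (le_trans (ler_wpM2l s0 m1b)).
(* The 5 in [C1] collects 2 from [s * m 1], as [s <= 2], 1 from the second moment, and 2 from [y 3],
   where the division by [s >= 1 / 2] doubles the error. *)
have ba : - (C1 * K) <= s ^+ 2 * (s - 1) - k2.
  rewrite main /C1; clear -smb m2a y3b k40; lra.
have bb : s ^+ 2 * (s - 1) - k2 <= C1 * K.
  rewrite main /C1; clear -sma m2b y3a k40; lra.
have C1K : C1 * K <= C1 * k2 by rewrite ler_wpM2l //; lra.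
have sqs : 1/4 <= s ^+ 2 by clear -s12; nra.
have Ck0 : 0 <= C1 * k2 by rewrite mulr_ge0 //; lra.
(* As [s ^ 2 >= 1 / 4], the relation first gives [s - 1 = O(k ^ 2)]. The square is then of order
   [k ^ 4]; 48 is 16 times the bound 3 on [s + 1]. *)
have ta : - (4 * (1 + C1) * k2) <= s - 1.
  have [h|h] := leP 0 (s - 1); first by clear -h Ck0 k20; lra.
  have : s ^+ 2 * (s - 1) <= 1 / 4 * (s - 1) by rewrite ler_wnM2r // ltW.
  by clear -ba C1K Ck0 k20; lra.
have tb : s - 1 <= 4 * (1 + C1) * k2.
  have [h|h] := leP (s - 1) 0; first by clear -h Ck0 k20; lra.
  have : 1 / 4 * (s - 1) <= s ^+ 2 * (s - 1) by rewrite ler_wpM2r // ltW.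
  by clear -bb C1K Ck0 k20; lra.
have t2 : (s - 1) ^+ 2 <= 16 * (1 + C1) ^+ 2 * K.
  rewrite Kk (_ : _ * (k2 * k2) = (4 * (1 + C1) * k2) ^+ 2); last by ring.
  rewrite -[leLHS]real_normK ?num_real // lerXn2r ?nnegrE // ?ler_norml ?ta ?tb //.
  by clear -ta tb; lra.
have t3 : (s - 1) ^+ 2 * (s + 1) <= 48 * (1 + C1) ^+ 2 * K.
  by have := sqr_ge0 (s - 1); clear -t2 s2 s12; nra.
have t4 : 0 <= (s - 1) ^+ 2 * (s + 1) by rewrite mulr_ge0 ?sqr_ge0 //; lra.
have t5 : s ^+ 2 * (s - 1) - (s - 1) = (s - 1) ^+ 2 * (s + 1) by ring.
by clear -ba bb t3 t4 t5; apply/andP; split; lra.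
Qed.

(** If the ground energy were below [- m - e], values within [e / 2] of 0 would give summands of at
    most [(1 + e / 2)^-1], and the few others at most [2 / e]; the sum could not reach 1. *)
Lemma min_spectrum_ge_bulk u (m e : R) : 1 <= m -> 0 < e ->
  (forall i, - m - e / 2 <= u i) ->
  (1 + e / 2)^-1 + M%:R^-1 * (\sum_i (e / 2 < `|u i|)%R%:R) * (2 / e) < 1 ->
  - m - e <= min_spectrum (mean_field u).
Proof.
move=> m1 e0 ui lt1; have Eu := min_spectrum_lt M0 u.
rewrite leNgt; apply/negP; have := secular_min_spectrum M0 u.
set E := min_spectrum _ in Eu * => F1 Em.
suff : secular u E < 1 by rewrite F1 ltxx.
apply: le_lt_trans lt1.
have -> : (1 + e / 2)^-1 = M%:R^-1 * \sum_(i < M) (1 + e / 2)^-1.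
  by rewrite sumr_const card_ord -[_^-1 *+ M]mulr_natl mulKf // gt_eqF.
rewrite -mulrA -mulrDr ler_pM2l ?invr_gt0 // mulr_suml -big_split /= ler_sum // => i _.
have [h|h] := ltP (e / 2) `|u i|.
  have hi := ui i.
  rewrite mul1r ler_wpDl ?invr_ge0 //; first lra.
  rewrite -[2 / e]invrK lef_pV2 ?posrE ?invr_gt0 ?divr_gt0 //; first by rewrite invf_div; lra.
  by lra.
rewrite mul0r addr0; move: h; rewrite ler_norml => /andP[h1 h2].
by rewrite lef_pV2 ?posrE; lra.
Qed.

(** Three regimes for the distance to [u i0 <= - p]: at least [p - d] in the bulk, at least [t + p]
    above the edge threshold [t], and at least the gap [g] below it. The last two are weighted by
    the number of values concerned. *)
Lemma localized_sum u i0 (p t d g : R) : 0 < g -> 0 < t + p -> d < p ->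
  u i0 <= - p ->
  (forall i j, i != j -> u i <= t -> u j <= t -> g <= `|u i - u j|) ->
  (forall j, u i0 <= u j) ->
  M%:R^-1 * \sum_(i | i != i0) (u i - u i0)^-1 <=
  (p - d)^-1 + M%:R^-1 * (\sum_i (d < `|u i|)%R%:R) / (t + p)
             + M%:R^-1 * (\sum_i (u i <= t)%R%:R) / g.
Proof.
move=> g0 tp dp ui0 gap umin.
have -> : (p - d)^-1 = M%:R^-1 * \sum_(i < M) (p - d)^-1.
  by rewrite sumr_const card_ord -[_^-1 *+ M]mulr_natl mulKf // gt_eqF.
rewrite -!mulrA -!mulrDr ler_pM2l ?invr_gt0 // !mulr_suml -!big_split /=.
rewrite [leRHS](bigID (fun i => i != i0)) /= ler_wpDr //.
  apply: sumr_ge0 => i _; rewrite !addr_ge0 ?invr_ge0 ?mulr_ge0 ?ler0n ?invr_ge0 //; lra.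
have pd : 0 <= (p - d)^-1 by rewrite invr_ge0; lra.
have tp' : 0 <= (t + p)^-1 by rewrite invr_ge0; lra.
apply: ler_sum => i ii0; have [ut|ut] := leP (u i) t.
  have ut0 : u i0 <= t by lra.
  have := gap i i0 ii0 ut ut0; rewrite ger0_norm ?subr_ge0 // => hg.
  rewrite mul1r ler_wpDl ?addr_ge0 ?mulr_ge0 //.
  by rewrite lef_pV2 ?posrE //; lra.
rewrite mul0r addr0; have [h|h] := ltP d `|u i|.
  by rewrite mul1r ler_wpDl // lef_pV2 ?posrE //; lra.
rewrite mul0r addr0; move: h; rewrite ler_norml => /andP[h1 h2].
by rewrite lef_pV2 ?posrE //; lra.
Qed.

End energy_bounds.

(** * Hausdorff distance and measurability *)

Section hausdorff.
Context (R : realType).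
Implicit Types (I J : set R) (r : R).

Definition near_set r I J := forall x, I x -> exists2 y, J y & `|x - y| <= r.

Let dist (x : R) J := inf [set `|x - y| | y in J].

Let dist_le x J y : J y -> dist x J <= `|x - y|.
Proof. by move=> Jy; apply: ge_inf; [exists 0 => _ [z _ <-] | exists y]. Qed.

Let dist_shift J x x' r : J !=set0 -> `|x - x'| <= r -> dist x J <= dist x' J + r.
Proof.
move=> [y0 Jy0] xx'; rewrite -lerBlDr; apply: lb_le_inf.
  by exists `|x' - y0|; exists y0.
move=> _ [y Jy <-]; rewrite lerBlDr; apply: le_trans (dist_le x Jy) _.
by rewrite -(subrKA x') addrC (le_trans (ler_normD _ _)) // lerD2l.
Qed.

Let dist_nearer I I' x r : I' !=set0 -> near_set r I' I ->
  dist x I <= dist x I' + r.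
Proof.
move=> [y0 Iy0] II'; rewrite -lerBlDr; apply: lb_le_inf.
  by exists `|x - y0|; exists y0.
move=> _ [y Iy <-]; rewrite lerBlDr; have [z Iz yz] := II' y Iy.
apply: le_trans (dist_le x Iz) _.
by rewrite -(subrKA y) (le_trans (ler_normD _ _)) // lerD2l.
Qed.

Let hausdorffE I J : J !=set0 -> hausdorff_distance I J =
  Num.max (sup [set dist x J | x in I]) (sup [set dist y I | y in J]).
Proof.
move=> _; congr (Num.max _ (sup _)).
apply: eq_imagel => y _; congr inf; apply: eq_imagel => x _; exact: distrC.
Qed.

Lemma hausdorff_distance_le I J r : I !=set0 -> J !=set0 ->
  near_set r I J -> near_set r J I -> hausdorff_distance I J <= r.
Proof.
move=> I0 J0 IJ JI; rewrite hausdorffE // ge_max; apply/andP; split.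
  case: I0 => x0 Ix0; apply: ge_sup; first by exists (dist x0 J); exists x0.
  by move=> _ [x Ix <-]; have [y Jy /(le_trans (dist_le x Jy))] := IJ x Ix.
case: J0 => x0 Ix0; apply: ge_sup; first by exists (dist x0 I); exists x0.
by move=> _ [x Ix <-]; have [y Jy /(le_trans (dist_le x Jy))] := JI x Ix.
Qed.

(** The common bound [B] makes the suprema on the right genuine least upper bounds rather than the
    default value of [sup]. *)
Lemma hausdorff_distance_lipschitz I I' J r (B : R) : I !=set0 -> I' !=set0 -> J !=set0 ->
  (forall x, I' x -> `|x| <= B) -> (forall x, J x -> `|x| <= B) ->
  near_set r I I' -> near_set r I' I ->
  hausdorff_distance I J <= hausdorff_distance I' J + r.
Proof.
move=> I0 I'0 J0 BI BJ II' I'I; rewrite !hausdorffE // ge_max -!lerBlDr.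
have ub (I1 I2 : set R) : I2 !=set0 -> (forall x, I1 x -> `|x| <= B) ->
    (forall x, I2 x -> `|x| <= B) ->
    forall x, I1 x -> dist x I2 <= sup [set dist x I2 | x in I1].
  move=> [y Iy] B1 B2 x Ix; apply: ub_le_sup; last by exists x.
  exists (B + B) => _ [z Iz <-]; apply: le_trans (dist_le z Iy) _.
  by apply: le_trans (ler_normB _ _) _; apply: lerD; [exact: B1|exact: B2].
apply/andP; split; rewrite le_max; apply/orP; [left|right]; rewrite lerBlDr.
  case: (I0) => x0 Ix0; apply: ge_sup; first by exists (dist x0 J); exists x0.
  move=> _ [x Ix <-]; have [x' Ix' xx'] := II' x Ix.
  by apply: le_trans (dist_shift J0 xx') _; rewrite lerD2r; exact: ub.
case: (J0) => x0 Ix0; apply: ge_sup; first by exists (dist x0 I); exists x0.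
move=> _ [y Jy <-]; apply: le_trans (dist_nearer y I'0 I'I) _.
by rewrite lerD2r; exact: ub.
Qed.

End hausdorff.

Section measurability.
Context (R : realType) (d : measure_display) (T : measurableType d).

(* The set is a countable union of preimages of boxes with rational centers. *)
Lemma measurable_lipschitz_superlevel (M : nat) (X : 'I_M -> T -> R)
    (f : ('I_M -> R) -> R) (K e : R) : 0 < K ->
  (forall u u' (r : R), 0 <= r -> (forall i, `|u i - u' i| <= r) -> f u <= f u' + K * r) ->
  (forall i, measurable_fun setT (X i)) ->
  measurable [set w | e < f (fun i => X i w)].
Proof.
move=> K0 flip mX.
pose box (p : {ffun 'I_M -> rat} * nat) : set ('I_M -> R) :=
  [set u | forall i, `|u i - ratr (p.1 i)| <= p.2.+1%:R^-1].
pose A (k : nat) : set T := if unpickle k is Some p then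
    [set w | box p `<=` [set u | e < f u] /\ box p (fun i => X i w)] else set0.
suff -> : [set w | e < f (fun i => X i w)] = \bigcup_k A k.
  apply: bigcup_measurable => k _; rewrite /A; case: unpickle => [p|//].
  have [h|h] := pselect (box p `<=` [set u | e < f u]); last first.
    by rewrite (_ : mkset _ = set0) // -subset0 => w [].
  rewrite (_ : mkset _ = \big[setI/setT]_(i < M)
      [set w | `|X i w - ratr (p.1 i)| <= p.2.+1%:R^-1]).
    apply: bigsetI_measurable => i _.
    rewrite -[X in measurable X]setTI.
    have mf : measurable_fun setT (fun w => `|X i w - ratr (p.1 i)|).
      by apply: measurableT_comp => //; apply: measurable_funD.
    exact: measurable_fun_le.
  apply/seteqP; split => w /=.
    by move=> [_ hw]; rewrite -bigcap_seq => i _; exact: hw.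
  rewrite -bigcap_seq => hw; split => // i; apply: hw => /=.
  by rewrite mem_index_enum.
apply/seteqP; split => w /=; last first.
  by move=> [k _]; rewrite /A; case: unpickle => // p [pe /pe].
set u := fun i => X i w => eu.
(* Two points of a box of radius [z] differ by at most [2 * z] in each coordinate, so
   [2 * K * z < f u - e] keeps the whole box in the superlevel set. *)
have [|n] := @ltr_add_invr R 0 ((f u - e) / (2 * K)).
  by rewrite divr_gt0 ?subr_gt0 ?mulr_gt0.
rewrite add0r => hn; have n0 : 0 < n.+1%:R^-1 :> R by rewrite invr_gt0 ltr0n.
move: hn n0; set z := n.+1%:R^-1 => hn n0.
have /choice[q hq] i : exists q : rat, `|u i - ratr q| <= z.
  have [|q] := @rat_in_itvoo R (u i - z) (u i + z).
    by rewrite ltrBlDr -addrA ltrDl addr_gt0.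
  by rewrite in_itv /= => /andP[h1 h2]; exists q; rewrite ler_norml; apply/andP; split; lra.
exists (pickle ([ffun i => q i], n)) => //; rewrite /A pickleK /=; split.
  move=> u' hu' /=.
  have := flip u u' (2 * z) _ _; rewrite mulr_ge0 ?(ltW n0) // => /(_ isT) flip'.
  have {}flip' : f u <= f u' + K * (2 * z).
    apply: flip' => i; have := hu' i; have := hq i; rewrite /= ffunE -/z !ler_norml.
    by move=> /andP[? ?] /andP[? ?]; lra.
  move: hn; rewrite ltr_pdivlMr ?mulr_gt0 // => hn; lra.
by move=> i /=; rewrite ffunE; exact: hq.
Qed.

End measurability.

Section spectrum_measurability.
Context (R : realType) (lambda : R).

Lemma limit_spectrum_neq0 : limit_spectrum lambda !=set0.
Proof. by exists (-1); left. Qed.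

Lemma limit_spectrum_bounded x : limit_spectrum lambda x -> `|x| <= 1 + `|lambda|.
Proof.
move=> [->|]; first by rewrite normrN1 lerDl.
rewrite /= in_itv /= -ler_norml => /le_trans; apply.
by rewrite ler_wpDl // ler_norm.
Qed.

Lemma spectrum_bounded (M : nat) (u : 'I_M -> R) (b : R) : (0 < M)%N ->
  (forall i, `|u i| <= b) -> forall E, spectrum (mean_field u) E -> `|E| <= b + 1.
Proof.
move=> M0 ub E; have uab i : - b <= u i <= b by have := ub i; rewrite ler_norml.
move=> /(spectrum_mean_field_sub M0 uab)[->|]; rewrite ler_norml; last lra.
have /andP[_ h] := uab (Ordinal M0); have := min_spectrum_lt M0 u (Ordinal M0).
have := min_spectrum_ge M0 (fun i => proj1 (andP (uab i))); lra.
Qed.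

Lemma measurable_hausdorff_gt (d : measure_display) (T : measurableType d)
    (M : nat) (X : 'I_M -> T -> R) (e : R) : (0 < M)%N ->
  (forall i, measurable_fun setT (X i)) ->
  measurable [set w | e < hausdorff_distance
     (spectrum (hamiltonian lambda (fun i => X i w))) (limit_spectrum lambda)].
Proof.
move=> M0 mX; pose k := kappa lambda M.
pose f (u : 'I_M -> R) :=
  hausdorff_distance (spectrum (hamiltonian lambda u)) (limit_spectrum lambda).
(* The summand 1 keeps the constant positive when [kappa] is 0, as for [M = 1], where its
   denominator vanishes. *)
apply: (@measurable_lipschitz_superlevel _ _ _ _ X f (1 + `|k|)) => //.
move=> u u' r r0 uu'.
have kr : `|k| * r <= (1 + `|k|) * r by rewrite ler_wpM2r // lerDr.
apply: (@le_trans _ _ (f u' + `|k| * r)); last by rewrite lerD2l.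
rewrite /f !hamiltonianE.
pose b := \big[Num.max/0]_i `|k * u' i|.
have ub i : `|k * u' i| <= b by exact: (le_bigmax _ (fun i => `|k * u' i|)).
have kr0 : 0 <= `|k| * r by rewrite mulr_ge0.
apply: (@hausdorff_distance_lipschitz _ _ _ _ _ (Num.max (b + 1) (1 + `|lambda|))).
- by exists (min_spectrum (mean_field (fun i => k * u i))); exact: min_spectrum_spectrum.
- by exists (min_spectrum (mean_field (fun i => k * u' i))); exact: min_spectrum_spectrum.
- exact: limit_spectrum_neq0.
- by move=> x /(spectrum_bounded M0 ub) h; rewrite le_max h.
- by move=> x /limit_spectrum_bounded h; rewrite le_max h orbT.
- move=> E /(mean_field_shift (_ : forall i, `|k * u i - k * u' i| <= _) kr0) [].
    by move=> i; rewrite -mulrBr normrM ler_wpM2l.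
  by move=> E' sE' ?; exists E' => //; rewrite distrC.
- move=> E /(mean_field_shift (_ : forall i, `|k * u' i - k * u i| <= _) kr0) [].
    by move=> i; rewrite -mulrBr normrM ler_wpM2l // distrC.
  by move=> E' sE' ?; exists E' => //; rewrite distrC.
Qed.

End spectrum_measurability.

(** * The standard Gaussian measure *)

Section gaussian.
Context (R : realType).
Local Notation mu := (@lebesgue_measure R).
Local Notation gamma := (@normal_prob R 0 1).

Lemma normal_pdf1E (m x : R) :
  normal_pdf m 1 x = normal_peak 1 * expR (- (x - m) ^+ 2 / 2).
Proof. by rewrite normal_pdfE ?oner_eq0 // /normal_fun expr1n. Qed.

Lemma normal_peak1_le1 : @normal_peak R 1 <= 1.
Proof.
have pi2 := @pi_ge2 R.
rewrite /normal_peak expr1n mul1r mulr2n invf_le1 ?sqrtr_gt0; last lra.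
rewrite -{1}sqrtr1 ler_wsqrtr //; lra.
Qed.

(* On [A] the standard density is at most [expR (- t ^+ 2 / 2)] times the density
   centered at [t]. *)
Lemma normal_prob_tilt (t : R) (A : set R) : measurable A ->
  (forall x, A x -> 0 <= t * (x - t)) -> (gamma A <= (expR (- t ^+ 2 / 2))%:E)%E.
Proof.
move=> mA At; rewrite -[leRHS]mule1 -(@integral_normal_pdf R t 1).
have mpdf m : measurable_fun setT (fun x : R => (normal_pdf m 1 x)%:E).
  by apply/measurable_EFinP; exact: measurable_normal_pdf.
have pdf0 m (x : R) : (0 <= (normal_pdf m 1 x)%:E)%E by rewrite lee_fin normal_pdf_ge0.
have e0 : (0 <= (expR (- t ^+ 2 / 2))%:E)%E by rewrite lee_fin expR_ge0.
rewrite -(ge0_integralZl mu measurableT (mpdf t) (fun x _ => pdf0 t x) e0).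
apply: (@le_trans _ _ (\int[mu]_(x in A)
    ((expR (- t ^+ 2 / 2))%:E * (normal_pdf t 1 x)%:E))%E); last first.
  apply: ge0_subset_integral => //; last 1 first.
  - by move=> x _; rewrite mule_ge0 ?lee_fin ?expR_ge0 ?normal_pdf_ge0.
  - by apply: measurable_funeM; exact: mpdf.
apply: ge0_le_integral => //.
- by apply: measurable_funTS; exact: mpdf.
- by apply: measurable_funeM; apply: measurable_funTS; exact: mpdf.
- move=> x Ax; rewrite -EFinM lee_fin !normal_pdf1E mulrCA.
  rewrite ler_pM2l ?normal_peak_gt0 ?oner_eq0 // -expRD ler_expR.
  have := At x Ax; rewrite subr0; nra.
Qed.

Lemma measurable_gt_norm (t : R) : measurable [set x : R | t < `|x|].
Proof.
have := @measurable_fun_ltr _ _ R setT (cst t) (fun x : R => `|x|).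
rewrite -[X in measurable X]setTI => h.
by apply: (h _ _ measurableT [set true]) => //; exact: normr_measurable.
Qed.

Lemma measurable_le_cst (t : R) : measurable [set x : R | x <= t].
Proof. by rewrite -set_itvNyc. Qed.

Lemma normal_prob_gt_norm (t : R) : 0 <= t ->
  (gamma [set x | (t < `|x|)%R] <= (2 * expR (- t ^+ 2 / 2))%:E)%E.
Proof.
move=> t0.
have m1 : measurable [set x : R | t <= x] by rewrite -set_itvcy.
have m2 := measurable_le_cst (- t).
apply: (@le_trans _ _ (gamma ([set x : R | t <= x] `|` [set x : R | x <= - t]))).
  apply: le_measure; rewrite ?inE; [exact: measurable_gt_norm|exact: measurableU|].
  move=> x /= ; case: (ler0P x) => [x0|x0] h; [right|left]; lra.
have := @measureU2 _ _ _ (normal_prob 0 1) _ _ m1 m2 => /le_trans; apply.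
rewrite mulrDl mul1r EFinD; apply: leeD.
  by apply: normal_prob_tilt => // x /= tx; nra.
by rewrite -[t in leRHS]opprK sqrrN; apply: normal_prob_tilt => // x /= tx; nra.
Qed.

Lemma normal_prob_le_tail (t : R) : 0 <= t ->
  (gamma [set x | (x <= - t)%R] <= (expR (- t ^+ 2 / 2))%:E)%E.
Proof.
move=> t0; rewrite -[t in leRHS]opprK sqrrN.
apply: normal_prob_tilt; first exact: measurable_le_cst.
by move=> x /= tx; nra.
Qed.

Lemma normal_prob_itv_le (t a b : R) : 0 <= t -> a <= b -> b <= - t ->
  (gamma `[a, b] <= ((b - a) * expR (- t ^+ 2 / 2))%:E)%E.
Proof.
move=> t0 ab bt.
apply: (@le_trans _ _ (\int[mu]_(x in `[a, b]) (expR (- t ^+ 2 / 2))%:E)%E).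
  apply: ge0_le_integral => //.
  - by move=> x _; rewrite lee_fin normal_pdf_ge0.
  - by apply/measurable_EFinP/measurable_funTS; exact: measurable_normal_pdf.
  - move=> x; rewrite /= in_itv /= => /andP[ax xb]; rewrite lee_fin normal_pdf1E.
    rewrite -[leRHS]mul1r ler_pM ?normal_peak_ge0 ?expR_ge0 ?normal_peak1_le1 //.
    rewrite ler_expR subr0; nra.
rewrite integral_cst //= lebesgue_measure_itv /= lte_fin.
have [_|ba] := ltP a b; first by rewrite -EFinD -EFinM mulrC.
by rewrite mule0 lee_fin mulr_ge0 ?expR_ge0 ?subr_ge0.
Qed.

Lemma normal_prob_itv_ge (m a b : R) : a <= b -> - m <= a -> b <= m ->
  (((b - a) * (normal_peak 1 * expR (- m ^+ 2 / 2)))%:E <= gamma `[a, b])%E.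
Proof.
move=> ab ma bm.
apply: (@le_trans _ _ (\int[mu]_(x in `[a, b]) (normal_peak 1 * expR (- m ^+ 2 / 2))%:E)%E).
  rewrite integral_cst //= lebesgue_measure_itv /= lte_fin.
  have [_|ba] := ltP a b; first by rewrite -EFinD -EFinM mulrC.
  by rewrite mule0 lee_fin mulr_le0_ge0 ?subr_le0 // mulr_ge0 ?expR_ge0 ?normal_peak_ge0.
apply: ge0_le_integral => //.
- by move=> x _; rewrite lee_fin mulr_ge0 ?expR_ge0 ?normal_peak_ge0.
- by apply/measurable_EFinP/measurable_funTS; exact: measurable_normal_pdf.
- move=> x; rewrite /= in_itv /= => /andP[ax xb]; rewrite lee_fin normal_pdf1E.
  by rewrite ler_pM2l ?normal_peak_gt0 ?oner_eq0 // ler_expR subr0; nra.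
Qed.

(** Integrals against [normal_prob] are expressed by its Radon-Nikodym derivative, which agrees
    almost everywhere with the density because both integrate to the same measure. *)
Lemma ge0_integral_normal_prob (f : R -> R) : measurable_fun setT f ->
  (forall x, 0 <= f x) ->
  (\int[gamma]_x (f x)%:E = \int[mu]_x (f x * normal_pdf 0 1 x)%:E)%E.
Proof.
move=> mf f0; have dom := @normal_prob_dominates R 0 1.
rewrite -(Radon_Nikodym_SigmaFinite.change_of_variables dom) //; last exact/measurable_EFinP.
have mpdf : measurable_fun setT (fun x : R => (normal_pdf 0 1 x)%:E).
  by apply/measurable_EFinP; exact: measurable_normal_pdf.
apply: ae_eq_integral => //.
- apply: emeasurable_funM; first exact/measurable_EFinP.
  exact: measurable_int (Radon_Nikodym_SigmaFinite.f_integrable _).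
- by apply/measurable_EFinP; apply: measurable_funM => //; exact: measurable_normal_pdf.
under [X in ae_eq _ _ _ X]eq_fun do rewrite EFinM.
apply: ae_eqe_mul2l; apply: integral_ae_eq => //.
  exact: Radon_Nikodym_SigmaFinite.f_integrable.
by move=> A _ mA; rewrite -Radon_Nikodym_SigmaFinite.f_integral.
Qed.

(** The integrand times the standard density is [s] times the centered density of standard deviation
    [s]. This identity supplies both the integrability of polynomials and the second moment. *)
Lemma normal_prob_gauss_mgf (s : R) : 0 < s ->
  (\int[gamma]_x (expR ((1 - s ^- 2) * x ^+ 2 / 2))%:E = s%:E)%E.
Proof.
move=> s0; rewrite ge0_integral_normal_prob; last 2 first.
- apply: measurableT_comp => //; apply: measurable_funM => //.
  by apply: measurable_funM => //; exact: measurable_funX.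
- by move=> x; exact: expR_ge0.
rewrite -[RHS]mule1 -(@integral_normal_pdf R 0 s).
have mpdf : measurable_fun setT (fun x : R => (normal_pdf 0 s x)%:E).
  by apply/measurable_EFinP; exact: measurable_normal_pdf.
have pdf0 (x : R) : setT x -> (0 <= (normal_pdf 0 s x)%:E)%E.
  by rewrite lee_fin normal_pdf_ge0.
have s0' : (0 <= s%:E)%E by rewrite lee_fin ltW.
rewrite -(ge0_integralZl mu measurableT mpdf pdf0 s0').
apply: eq_integral => x _; rewrite -EFinM; congr EFin.
rewrite normal_pdf1E normal_pdfE ?gt_eqF // mulrCA -expRD subr0.
have -> : normal_peak s = s^-1 * normal_peak 1.
  rewrite /normal_peak expr1n mul1r -mulrnAr sqrtrM ?sqr_ge0 // sqrtr_sqr.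
  by rewrite gtr0_norm // invfM.
rewrite !mulrA mulfV ?gt_eqF // mul1r /normal_fun subr0; congr (_ * expR _).
by field; rewrite gt_eqF.
Qed.

End gaussian.

(** * Moments of the standard Gaussian measure *)

Section gaussian_moments.
Context (R : realType).
Local Notation mu := (@lebesgue_measure R).
Local Notation gamma := (@normal_prob R 0 1).

Lemma ge0_integrable_normal (f : R -> R) (c : R) : measurable_fun setT f ->
  (forall x, 0 <= f x) -> (\int[gamma]_x (f x)%:E = c%:E)%E ->
  gamma.-integrable setT (EFin \o f) /\ (\int[gamma]_x f x)%R = c.
Proof.
move=> mf f0 fc; split; last by rewrite /Rintegral fc.
apply/integrableP; split; first exact/measurable_EFinP.
suff -> : (\int[gamma]_x `|(EFin \o f) x| = \int[gamma]_x (f x)%:E)%E by rewrite fc ltry.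
by apply: eq_integral => x _; rewrite /= ger0_norm.
Qed.

Lemma gauss_fun_integrable (s : R) : 0 < s ->
  let f := fun x => expR ((1 - s ^- 2) * x ^+ 2 / 2) in
  gamma.-integrable setT (EFin \o f) /\ (\int[gamma]_x f x)%R = s.
Proof.
move=> s0 f; apply: ge0_integrable_normal; last exact: normal_prob_gauss_mgf.
- apply: measurableT_comp => //; apply: measurable_funM => //.
  by apply: measurable_funM => //; exact: measurable_funX.
- by move=> x; exact: expR_ge0.
Qed.

(** The exponent [x ^ 2 / 4] is the one of [gauss_fun_integrable] for [s = sqrt 2]. Degree 8
    suffices, since Chebyshev's inequality is applied to polynomials of degree at most 4. *)
Lemma expr8_le_expR (x : R) : 1 + x ^+ 8 <= 4 ^+ 4 * 4`!%:R * expR (x ^+ 2 / 4).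
Proof.
set y := _ / 4.
have y0 : 0 <= y by rewrite mulr_ge0 ?sqr_ge0.
have := @expR_ge1Dxn R y 3 y0.
have x8 : x ^+ 8 = 4 ^+ 4 * y ^+ 4.
  by rewrite -exprMn mulrC divfK // -exprM.
rewrite x8.
have f0 : 0 < 4`!%:R :> R by rewrite ltr0n fact_gt0.
rewrite -(ler_pM2l f0) mulrDr mulrCA mulfV ?gt_eqF // !mulr1 => h.
have K : 1 <= 4 ^+ 4 :> R by rewrite exprn_ege1 // ler1n.
have K0 : 0 <= 4 ^+ 4 :> R by apply: le_trans K.
rewrite -mulrA; apply: le_trans (ler_wpM2l K0 h).
rewrite mulrDr lerD2r; apply: le_trans K _; rewrite ler_peMr // ler1n fact_gt0 //.
Qed.

Lemma normal_integrable (f : R -> R) (C : R) : measurable_fun setT f ->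
  (forall x, `|f x| <= C * (1 + x ^+ 8)) -> gamma.-integrable setT (EFin \o f).
Proof.
move=> mf fC.
have s0 : 0 < Num.sqrt 2 :> R by rewrite sqrtr_gt0.
have [ig _] := gauss_fun_integrable s0.
have ig' := @integrableZl _ _ _ gamma setT measurableT (`|C| * (4 ^+ 4 * 4`!%:R)) _ ig.
apply: le_integrable ig' => //; first exact/measurable_EFinP.
move=> x _; rewrite /= lee_fin; apply: le_trans (fC x) _.
have K0 : 0 <= 4 ^+ 4 * 4`!%:R :> R by rewrite mulr_ge0 ?exprn_ge0 ?ler0n.
rewrite ger0_norm; last by rewrite mulr_ge0 ?expR_ge0 // mulr_ge0.
rewrite sqr_sqrtr ?ler0n //.
have -> : (1 - 2^-1) * x ^+ 2 / 2 = x ^+ 2 / 4 by field.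
have x80 : 0 <= x ^+ 8 by exact: exprn_even_ge0.
rewrite -mulrA; apply: (@le_trans _ _ (`|C| * (1 + x ^+ 8))).
  by rewrite ler_wpM2r ?ler_norm // addr_ge0.
by rewrite ler_wpM2l // expr8_le_expR.
Qed.

Lemma normX_le_even (x : R) m n : (m <= n)%N -> ~~ odd n ->
  `|x| ^+ m <= 1 + x ^+ n.
Proof.
move=> mn en; have -> : x ^+ n = `|x| ^+ n.
  by rewrite -normrX ger0_norm // exprn_even_ge0.
have [x1|x1] := leP `|x| 1.
  by rewrite ler_wpDr ?exprn_ge0 // exprn_ile1.
by rewrite ler_wpDl // ler_weXn2l // ltW.
Qed.

Lemma normal_integrable_exp n : (n <= 8)%N ->
  gamma.-integrable setT (EFin \o (fun x : R => x ^+ n)).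
Proof.
move=> n8; apply: (@normal_integrable _ 1); first exact: measurable_funX.
by move=> x; rewrite mul1r normrX normX_le_even.
Qed.

(* Integrating [1 - h x^2 / 2 <= expR (- h x^2 / 2)], whose right-hand side has
   the integral [s] for [1 + h = s^-2], bounds the second moment [m] by
   [2 s^2 / (1 + s)] from below for [s < 1] and from above for [s > 1]. *)
Lemma normal_moment2 : (\int[gamma]_x (x ^+ 2))%R = 1.
Proof.
set m := Rintegral _ _ _.
have m0 : 0 <= m by apply: Rintegral_ge0 => x _; exact: sqr_ge0.
have key s : 0 < s -> 1 - (s ^- 2 - 1) / 2 * m <= s.
  move=> s0; have [ig gs] := gauss_fun_integrable s0; rewrite -[leRHS]gs.
  have i1 : gamma.-integrable setT (EFin \o cst (1 : R)).
    by apply: finite_measure_integrable_cst.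
  have i2 := @normal_integrable_exp 2 isT.
  have i3 : gamma.-integrable setT (EFin \o (fun x : R => (s ^- 2 - 1) / 2 * x ^+ 2)).
    have := @integrableZl _ _ _ gamma setT measurableT ((s ^- 2 - 1) / 2) _ i2.
    by apply: eq_integrable => // x _; rewrite /= EFinM.
  have -> : 1 - (s ^- 2 - 1) / 2 * m
      = (\int[gamma]_x (1 - (s ^- 2 - 1) / 2 * x ^+ 2))%R.
    rewrite RintegralB // RintegralZl // Rintegral_cst // mul1r.
    by rewrite [X in fine X]probability_setT.
  apply: le_Rintegral => //.
    by apply: eq_integrable (integrableB _ i1 i3).
  move=> x _; have := expR_ge1Dx ((1 - s ^- 2) * x ^+ 2 / 2); lra.
have s2 s : 0 < s -> s ^- 2 * s ^+ 2 = 1 :> R.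
  by move=> s0; rewrite mulVf // gt_eqF // exprn_gt0.
(* For the midpoint [s = (1 + m) / 2] one has [2 * s ^ 2 - m * (1 + s) = (1 - m) / 2], whose sign
   contradicts the bound in both cases. *)
have [m1|m1|//] := ltgtP m 1.
  pose s := (1 + m) / 2; have s0 : 0 < s by rewrite /s; lra.
  have := key s s0; rewrite -subr_ge0.
  rewrite -(pmulr_rge0 _ (exprn_gt0 2 s0)).
  have -> : s ^+ 2 * (s - (1 - (s ^- 2 - 1) / 2 * m)) =
    s ^+ 2 * (s - 1) + (s ^- 2 * s ^+ 2 - s ^+ 2) / 2 * m by ring.
  rewrite s2 // /s => h; exfalso; move: h; rewrite leNgt => /negP; apply.
  nra.
pose s := (1 + m) / 2; have s0 : 0 < s by rewrite /s; lra.
have := key s s0; rewrite -subr_ge0.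
rewrite -(pmulr_rge0 _ (exprn_gt0 2 s0)).
have -> : s ^+ 2 * (s - (1 - (s ^- 2 - 1) / 2 * m)) =
  s ^+ 2 * (s - 1) + (s ^- 2 * s ^+ 2 - s ^+ 2) / 2 * m by ring.
rewrite s2 // /s => h; exfalso; move: h; rewrite leNgt => /negP; apply.
nra.
Qed.

(** Reflection is available for nonnegative even integrands, so [x ^ n] is written as [2 * p - a]
    with [a] the even function [|x| ^ n] and [p] the positive part of [x ^ n]; symmetry gives [a]
    twice the integral of [p]. *)
Lemma normal_moment_odd n : odd n -> (n <= 8)%N -> (\int[gamma]_x (x ^+ n))%R = 0.
Proof.
move=> on n8.
pose a (x : R) := `|x| ^+ n; pose p (x : R) := (x ^+ n + `|x| ^+ n) / 2.
have ma : measurable_fun setT a by apply: measurable_funX; exact: normr_measurable.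
have mp : measurable_fun setT p.
  by apply: measurable_funM => //; apply: measurable_funD => //; exact: measurable_funX.
have a0 x : 0 <= a x by exact: exprn_ge0.
have p0 x : 0 <= p x.
  by rewrite divr_ge0 // -lerBlDr sub0r -normrX lerNl -normrN ler_norm.
have ia : gamma.-integrable setT (EFin \o a).
  apply: (@normal_integrable _ 1) => // x; rewrite ger0_norm // mul1r.
  exact: normX_le_even.
have ip : gamma.-integrable setT (EFin \o p).
  apply: (@normal_integrable _ 1) => // x; rewrite ger0_norm // mul1r.
  have := @normX_le_even x n 8 n8 isT; have := ler_norm (x ^+ n); rewrite normrX /p; lra.
have pa : (\int[gamma]_x (a x)%:E = 2%:E * \int[gamma]_x (p x)%:E)%E.
  rewrite !ge0_integral_normal_prob // ge0_symfun_integralT.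
  - congr *%E; rewrite integral_mkcond; apply: eq_integral => x _.
    rewrite patchE; case: ifPn => [|/negP]; rewrite inE /= => x0.
      by congr (_ * _)%:E; rewrite /p /a ger0_norm //; field.
    move/negP: x0; rewrite -ltNge => x0; rewrite /p ltr0_norm // exprNn.
    by rewrite -signr_odd on expr1 mulN1r subrr !mul0r.
  - by move=> x; rewrite mulr_ge0 ?normal_pdf_ge0.
  - move=> x; apply: cvgM; last by apply: continuous_normal_pdf; rewrite oner_eq0.
    by apply: (@continuous_comp _ _ _ (fun x : R => `|x|) (fun x : R => x ^+ n));
      [exact: norm_continuous | exact: exprn_continuous].
  - by move=> x /=; rewrite !normal_pdf1E !subr0 /a normrN sqrrN.
have {}pa : (\int[gamma]_x a x)%R = 2 * (\int[gamma]_x p x)%R.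
  by rewrite /Rintegral pa fineM // integrable_fin_num.
have -> : (\int[gamma]_x (x ^+ n))%R = (\int[gamma]_x (2 * p x - a x))%R.
  by apply: eq_Rintegral => x _; rewrite /p /a; field.
rewrite RintegralB //.
  by rewrite RintegralZl // pa subrr.
by apply: eq_integrable (integrableZl _ 2 ip) => // x _; rewrite /= EFinM.
Qed.

End gaussian_moments.

(** * Independent Gaussian variables *)

Section union_bound.
Context (R : realType) (d : measure_display) (T : measurableType d)
  (P : probability T R) (I : finType).

Lemma measurable_exists (F : I -> set T) : (forall i, measurable (F i)) ->
  measurable [set w | exists i, F i w].
Proof.
move=> mF; rewrite (_ : mkset _ = \bigcup_(i in [set: I]) F i).
  by apply: fin_bigcup_measurable => //; exact: finite_finset.
apply/seteqP; split => w /=; first by move=> [i Fi]; exists i.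
by move=> [i _ Fi]; exists i.
Qed.

Lemma probability_exists_le (F : I -> set T) (b : R) :
  (forall i, measurable (F i)) -> (forall i, (P (F i) <= b%:E)%E) ->
  (P [set w | exists i, F i w] <= (#|I|%:R * b)%:E)%E.
Proof.
move=> mF Fb.
have h (r : seq I) : measurable (\big[setU/set0]_(i <- r) F i) /\
    (P (\big[setU/set0]_(i <- r) F i) <= ((size r)%:R * b)%:E)%E.
  elim: r => [|i r [mr Pr]]; first by rewrite big_nil measure0 mul0r.
  rewrite big_cons; split; first exact: measurableU.
  apply: le_trans (measureU2 _ _ _) _ => //.
  by rewrite /= -natr1 mulrDl mul1r addrC EFinD leeD.
have [_] := h (enum I); rewrite -cardE; apply: le_trans.
rewrite le_eqVlt; apply/orP; left; apply/eqP; congr (P _).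
rewrite -bigcup_seq; apply/seteqP; split => w /=.
  by move=> [i Fi]; exists i => //=; rewrite mem_enum.
by move=> [i _ Fi]; exists i.
Qed.

End union_bound.

Section iid_events.
Context (R : realType) (d : measure_display) (T : measurableType d)
  (P : probability T R) (M : nat) (X : 'I_M -> {RV P >-> R}).
Hypothesis iidX : iid_standard_gaussian X.
Local Notation gamma := (@normal_prob R 0 1).

Lemma iid_preimage i (B : set R) : measurable B -> P (X i @^-1` B) = gamma B.
Proof. by move=> mB; have := iidX.2 i B mB. Qed.

Lemma measurable_preimage i (B : set R) : measurable B -> measurable (X i @^-1` B).
Proof. by move=> mB; rewrite -[X in measurable X]setTI; exact: measurable_funPT. Qed.

Lemma fin_numP_gamma (B : set R) : measurable B -> gamma B \is a fin_num.
Proof. by move=> mB; exact: fin_num_measure. Qed.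

Lemma iid_exists_le (B : set R) (p : R) : measurable B -> (gamma B <= p%:E)%E ->
  (P [set w | exists i, B (X i w)] <= (M%:R * p)%:E)%E.
Proof.
move=> mB Bp.
rewrite -[M in leRHS]card_ord; apply: (probability_exists_le (F := fun i => X i @^-1` B)).
  by move=> i; exact: measurable_preimage.
by move=> i; rewrite iid_preimage.
Qed.

Lemma iid_pair i j (A B : set R) : i != j -> measurable A -> measurable B ->
  P (X i @^-1` A `&` X j @^-1` B) = (gamma A * gamma B)%E.
Proof.
move=> ij mA mB; pose D k := if k == i then A else B.
have mD k : measurable (D k) by rewrite /D; case: ifP.
have := iidX.1 [set i; j]%SET D mD.
rewrite big_setU1 ?inE //= big_set1 !iid_preimage // /D eqxx eq_sym (negPf ij).
move=> <-; congr (P _); apply/seteqP; split => w /=.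
  by move=> [Ai Bj] k; rewrite !inE => /orP[] /eqP ->; rewrite ?eqxx // eq_sym (negPf ij).
move=> h; split; first by have := h i; rewrite !inE eqxx => /(_ isT).
by have := h j; rewrite !inE eqxx orbT eq_sym (negPf ij) => /(_ isT).
Qed.

Lemma iid_none_le (B : set R) (p : R) : measurable B -> 0 <= p -> (p%:E <= gamma B)%E ->
  (P [set w | forall i, ~ B (X i w)] <= (expR (- (p * M%:R)))%:E)%E.
Proof.
move=> mB p0 pB.
have := iidX.1 [set: 'I_M]%SET (fun=> ~` B) (fun=> measurableC mB).
have -> : [set w | forall i, i \in [set: 'I_M]%SET -> (~` B) (X i w)] =
          [set w | forall i, ~ B (X i w)].
  by apply/seteqP; split => w /= h i; have := h i; rewrite inE // => /(_ isT).
move=> ->; have gB := fin_numP_gamma mB.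
have -> : (\prod_(i in [set: 'I_M]%SET) P (X i @^-1` (~` B)))%E =
    ((1 - fine (gamma B)) ^+ M)%:E.
  have gC : gamma (~` B) = (1 - fine (gamma B))%:E.
    by have := probability_setC (normal_prob 0 1) mB; rewrite EFinB fineK.
  under eq_bigr => i _ do (rewrite iid_preimage ?gC; last exact: measurableC).
  rewrite prodEFin prodr_const cardsT card_ord //.
have p1 : p <= fine (gamma B) by rewrite -lee_fin fineK.
have pB1 : fine (gamma B) <= 1 by rewrite -lee_fin fineK // probability_le1.
rewrite lee_fin mulrC -mulrN expRM_natl lerXn2r ?nnegrE ?expR_ge0 ?subr_ge0 //.
apply: le_trans (expR_ge1Dx _); lra.
Qed.

(** Markov's inequality for the number of hits. *)
Lemma iid_count_le (B : set R) (p t : R) : measurable B -> (gamma B <= p%:E)%E ->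
  0 < t -> 
  (P [set w | (t <= \sum_i \1_B (X i w))%R] <= (M%:R * p / t)%:E)%E.
Proof.
move=> mB Bp t0.
have mS : measurable_fun setT (fun w => \sum_i \1_B (X i w) : R).
  apply: measurable_sum => i; apply: measurableT_comp => //.
have S0 w : 0 <= \sum_i \1_B (X i w) :> R by apply: sumr_ge0.
have := @le_integral_abse _ _ _ P setT measurableT (fun w => (\sum_i \1_B (X i w))%:E) t _ t0.
rewrite setTI => h.
rewrite EFinM [X in (_ <= X)%E]muleC lee_pdivlMl //.
have -> : [set w | (t <= \sum_i \1_B (X i w))%R] =
    [set w | (t%:E <= `|(\sum_i \1_B (X i w))%:E|)%E].
  by apply/seteqP; split => w /=; rewrite lee_fin ger0_norm.
apply: le_trans (h _) _; first exact/measurable_EFinP.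
under eq_integral => w _ do rewrite gee0_abs ?lee_fin // -sumEFin.
rewrite ge0_integral_sum //=; last first.
  by move=> i; apply/measurable_EFinP; apply: measurableT_comp.
apply: (@le_trans _ _ (\sum_(i < M) p%:E)%E); last first.
  by rewrite sumEFin sumr_const card_ord mulr_natl.
apply: lee_sum => i _; rewrite -(iid_preimage i mB) in Bp.
apply: le_trans Bp.
have := @integral_indic _ _ _ P setT measurableT _ (measurable_preimage i mB).
by rewrite setIT => <-.
Qed.

(** The joint law of [X i] and [X j] agrees with the product measure on rectangles, hence
    everywhere, and Fubini's theorem factors the integral. *)
Lemma iid_expectation_mul (f : R -> R) i j : i != j -> measurable_fun setT f ->
  gamma.-integrable setT (EFin \o f) -> (\int[gamma]_x f x)%R = 0 ->
  P.-integrable setT (fun w => (f (X i w) * f (X j w))%:E) ->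
  (\int[P]_w (f (X i w) * f (X j w))%:E = 0)%E.
Proof.
move=> ij mf intf f0 intP.
pose Z w := (X i w : measurableTypeR R, X j w : measurableTypeR R).
have mZ : measurable_fun setT Z.
  apply: measurable_fun_pair; first exact: (measurable_funPT (X i)).
  exact: (measurable_funPT (X j)).
pose F (z : measurableTypeR R * measurableTypeR R) := (f z.1 * f z.2)%:E.
have mF : measurable_fun setT F.
  apply/measurable_EFinP; apply: measurable_funM.
    by apply: (measurableT_comp mf); exact: measurable_fst.
  by apply: (measurableT_comp mf); exact: measurable_snd.
have -> : (\int[P]_w (f (X i w) * f (X j w))%:E = \int[pushforward P Z]_z F z)%E.
  by rewrite integral_pushforward.
have prodE (A : set (measurableTypeR R * measurableTypeR R)) : measurable A ->
    (gamma \x gamma)%E A = pushforward P Z A.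
  apply: product_measure_unique => A1 A2 mA1 mA2.
  by rewrite /pushforward -(iid_pair ij).
rewrite (eq_measure_integral (gamma \x gamma)%E); last first.
  by move=> A mA _; apply/esym; exact: prodE.
have mf' : measurable_fun setT (EFin \o f) by exact/measurable_EFinP.
have i0 : (\int[gamma]_y (f y)%:E = 0)%E.
  by rewrite -[LHS]fineK ?integrable_fin_num // -/(Rintegral _ _ _) f0.
have iF : (gamma \x gamma)%E.-integrable setT F.
  apply/(integrable12ltyP _ _ mF).
  have ia := integrable_abse intf.
  have inner x : (\int[gamma]_y `|F (x, y)| = `|(f x)%:E| * \int[gamma]_y `|(f y)%:E|)%E.
    rewrite -ge0_integralZl //=; last exact: measurable_int (integrable_abse intf).
    by apply: eq_integral => y _; rewrite /F normrM.
  under eq_integral do rewrite inner.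
  rewrite ge0_integralZr //; last exact: integral_ge0.
    by rewrite lte_mul_pinfty ?integral_ge0 // ?ge0_fin_numE ?integral_ge0 //;
      case/integrableP: intf.
  exact: measurableT_comp.
rewrite -integral12_prod_meas1 //= /fubini_F.
transitivity (\int[gamma]_x (0 : \bar R))%E; last by rewrite integral0.
apply: eq_integral => x _; rewrite /F /=.
under eq_integral do rewrite EFinM.
by rewrite integralZl // i0 mule0.
Qed.

(** Chebyshev's inequality: in the expansion of the squared sum only the [M] diagonal terms
    survive. *)
Lemma iid_mean_deviation (f : R -> R) (K t : R) : measurable_fun setT f ->
  gamma.-integrable setT (EFin \o f) -> (\int[gamma]_x f x)%R = 0 ->
  gamma.-integrable setT (EFin \o (fun x => f x ^+ 2)) ->
  (\int[gamma]_x (f x ^+ 2))%R = K -> 0 < t ->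
  (P [set w | (t <= `|\sum_i f (X i w)|)%R] <= (M%:R * K / t ^+ 2)%:E)%E.
Proof.
move=> mf intf f0 intf2 fK t0.
have mfX i : measurable_fun setT (fun w => f (X i w)).
  by apply: measurableT_comp => //; exact: (measurable_funPT (X i)).
have mf2 : measurable_fun setT (fun x => (f x ^+ 2)%:E).
  by apply/measurable_EFinP; exact: measurable_funX.
have E2 i : (\int[P]_w ((f (X i w)) ^+ 2)%:E = K%:E)%E.
  pose Y w := X i w : measurableTypeR R.
  have mY : measurable_fun setT Y by exact: (measurable_funPT (X i)).
  have -> : (\int[P]_w ((f (X i w)) ^+ 2)%:E = \int[pushforward P Y]_x (f x ^+ 2)%:E)%E.
    by rewrite ge0_integral_pushforward // => y _; rewrite lee_fin sqr_ge0.
  rewrite (eq_measure_integral (normal_prob 0 1)); last by move=> A mA _; exact: iidX.2.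
  by rewrite -fK fineK // integrable_fin_num.
have i2 i : P.-integrable setT (fun w => (f (X i w) ^+ 2)%:E).
  apply/integrableP; split; first by apply/measurable_EFinP; exact: measurable_funX.
  under eq_integral do rewrite gee0_abs ?lee_fin ?sqr_ge0 //.
  by rewrite E2 ltry.
have iij i j : P.-integrable setT (fun w => (f (X i w) * f (X j w))%:E).
  have i3 := integrableD measurableT (i2 i) (i2 j).
  apply: le_integrable i3 => //; first by apply/measurable_EFinP; exact: measurable_funM.
  move=> w _ /=; rewrite lee_fin [leRHS]ger0_norm ?addr_ge0 ?sqr_ge0 // ler_norml.
  by have := sqr_ge0 (f (X i w) - f (X j w)); have := sqr_ge0 (f (X i w) + f (X j w)); nra.
have mS : measurable_fun setT (fun w => (\sum_i f (X i w)) ^+ 2 : R).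
  by apply: measurable_funX; apply: measurable_sum.
have t20 : 0 < t ^+ 2 by exact: exprn_gt0.
have := @le_integral_abse _ _ _ P setT measurableT
  (fun w => ((\sum_i f (X i w)) ^+ 2)%:E) (t ^+ 2) _ t20.
rewrite setTI => h.
rewrite EFinM [X in (_ <= X)%E]muleC lee_pdivlMl //.
have -> : [set w | (t <= `|\sum_i f (X i w)|)%R] =
    [set w | ((t ^+ 2)%:E <= `|((\sum_i f (X i w)) ^+ 2)%:E|)%E].
  apply/seteqP; split => w /=; rewrite lee_fin normrX.
    by move=> tS; rewrite lerXn2r ?nnegrE // ltW.
  by rewrite ler_pXn2r ?nnegrE // ltW.
apply: le_trans (h _) _; first exact/measurable_EFinP.
under eq_integral => w _.
  rewrite gee0_abs ?lee_fin ?sqr_ge0 // expr2 mulr_suml -sumEFin.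
  under eq_bigr do rewrite mulr_sumr -sumEFin.
  over.
rewrite integral_sum //; last by move=> i; apply: integrable_sum.
apply: (@le_trans _ _ (\sum_(i < M) K%:E)%E); last first.
  by rewrite sumEFin sumr_const card_ord mulr_natl.
apply: lee_sum => i _; rewrite integral_sum // (bigD1 i) //= big1 => [|j ji].
  by rewrite adde0 -(E2 i); under [leRHS]eq_integral do rewrite expr2.
by apply: iid_expectation_mul => //; rewrite eq_sym.
Qed.

End iid_events.

(** * Separation of extreme values *)

Section iid_gap.
Context (R : realType) (d : measure_display) (T : measurableType d)
  (P : probability T R) (M : nat) (X : 'I_M -> {RV P >-> R}).
Hypothesis iidX : iid_standard_gaussian X.
Local Notation gamma := (@normal_prob R 0 1).

(* Two variables at distance less than [s] fall into a common cell of length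
   [2 s]; the union bound runs over pairs of indices and over the cells. *)
Lemma iid_gap (t s L : R) : 0 <= t -> 0 < s -> 0 <= L ->
  exists N : set T, [/\ measurable N,
    (P N <= (4 * M%:R ^+ 2 * s * (L + s) * expR (- t ^+ 2))%:E)%E &
    forall w, ~ N w -> forall i j, i != j ->
      - L <= X i w <= - t -> - L <= X j w <= - t -> s <= `|X i w - X j w|].
Proof.
move=> t0 s0 L0.
pose K := (Num.truncn (L / s)).+1.
(* Neighboring cells overlap in half of their length. Rounding the larger value up to the grid
   selects a cell which also contains a value less than [s] below it. *)
pose B (k : nat) := `[- t - k.+2%:R * s, - t - k%:R * s]%classic : set R.
have mB k : measurable (B k) by exact: measurable_itv.
pose F (p : 'I_M * 'I_M * 'I_K) :=
  if p.1.1 == p.1.2 then set0 else X p.1.1 @^-1` B p.2 `&` X p.1.2 @^-1` B p.2.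
have mF p : measurable (F p).
  by rewrite /F; case: ifP => // _; apply: measurableI; apply: measurable_preimage.
have e0 := expR_ge0 (- t ^+ 2 / 2); set e := expR _ in e0.
have gB k : (gamma (B k) <= (2 * s * e)%:E)%E.
  have -> : 2 * s * e = (- t - k%:R * s - (- t - k.+2%:R * s)) * e.
    by congr (_ * _); rewrite -addn2 natrD; ring.
  apply: normal_prob_itv_le => //.
    by rewrite lerD2l lerN2 ler_wpM2r ?ler_nat ?ltW // ltnW.
  by rewrite gerBl mulr_ge0 // ltW.
exists [set w | exists p, F p w]; split.
- exact: measurable_exists.
- have FP p : (P (F p) <= ((2 * s * e) ^+ 2)%:E)%E.
    rewrite /F; case: ifPn => [_|ij].
      by rewrite measure0 lee_fin sqr_ge0.
    by rewrite iid_pair // expr2 EFinM lee_pmul.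
  apply: le_trans (probability_exists_le mF FP) _.
  rewrite lee_fin !card_prod !card_ord !natrM.
  have Ks : K%:R * s <= L + s.
    rewrite /K -natr1 mulrDl mul1r lerD2r -ler_pdivlMr //.
    by rewrite truncn_le // divr_ge0 // ltW.
  have -> : expR (- t ^+ 2) = e ^+ 2 by rewrite -expRM_natl; congr expR; field.
  have M2 : 0 <= (M%:R ^+ 2 : R) by exact: sqr_ge0.
  rewrite (_ : _ * (2 * s * e) ^+ 2 = 4 * M%:R ^+ 2 * s * e ^+ 2 * (K%:R * s)); last by ring.
  rewrite [leRHS](_ : _ = 4 * M%:R ^+ 2 * s * e ^+ 2 * (L + s)); last by ring.
  by rewrite ler_wpM2l // !mulr_ge0 ?sqr_ge0 // ltW.
- move=> w Nw; suff key i j : i != j -> X i w <= X j w ->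
      - L <= X i w <= - t -> - L <= X j w <= - t -> s <= `|X i w - X j w|.
    move=> i j ij hi hj; have [h|/ltW h] := leP (X i w) (X j w); first exact: key.
    by rewrite distrC; apply: key => //; rewrite eq_sym.
  move=> ij Xij /andP[i1 i2] /andP[j1 j2]; rewrite leNgt; apply/negP => lt.
  apply: Nw; have z0 : 0 <= (- t - X j w) / s by rewrite divr_ge0 ?subr_ge0 // ltW.
  pose k := Num.truncn ((- t - X j w) / s).
  have /andP[k1 k2] := truncn_itv z0; rewrite -/k in k1 k2.
  have kK : (k < K)%N.
    rewrite ltnS; apply: le_truncn; rewrite ler_pM2r ?invr_gt0 //; lra.
  exists (i, j, Ordinal kK); rewrite /F /= (negPf ij).
  move: k1 k2; rewrite ler_pdivlMr // ltr_pdivrMr // => k1 k2.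
  move: lt; rewrite ler0_norm ?subr_le0 // opprB => lt.
  have k3 : k.+2%:R * s = k.+1%:R * s + s by rewrite -[k.+2%:R]natr1; ring.
  have k4 : k.+1%:R * s = k%:R * s + s by rewrite -[k.+1%:R]natr1; ring.
  by split; rewrite /B /= in_itv /=; apply/andP; split; lra.
Qed.

End iid_gap.

(** * High-probability events *)

Section log_scale.
Context (R : realType).

(** This is the leading order of the maximum of [M] standard Gaussian variables and the denominator
    of [kappa]. *)
Definition log_scale (M : nat) : R := Num.sqrt (2 * ln (M%:R : R)).
Local Notation L := log_scale.

Lemma log_scale_ge0 M : 0 <= L M. Proof. exact: sqrtr_ge0. Qed.

Lemma natr_log_scale M : (0 < M)%N -> M%:R = expR (L M ^+ 2 / 2).
Proof.
move=> M0; rewrite sqr_sqrtr; last by rewrite mulr_ge0 // ln_ge0 // ler1n.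
by rewrite mulrAC divff // mul1r lnK // posrE ltr0n.
Qed.

Lemma log_scale_large (A : R) : \forall M \near \oo, (0 < M)%N /\ A <= L M.
Proof.
near=> M; have M0 : (0 < M)%N by near: M; exact: nbhs_infty_gt.
split => //; have [A0|A0] := leP A 0; first exact: le_trans (log_scale_ge0 M).
have : expR (A ^+ 2 / 2) <= M%:R by near: M; exact: nbhs_infty_ger.
rewrite (natr_log_scale M0) ler_expR ler_pM2r ?invr_gt0 // ler_pXn2r ?nnegrE //.
  exact: ltW.
exact: log_scale_ge0.
Unshelve. all: by end_near. Qed.

(** Failure probabilities come out as a power of [L] times a Gaussian in [L]; this reduces them to
    the single rate [C / L]. One term of the exponential series, of order [n + 1], is enough. *)
Lemma exp_decay (c : R) n : 0 < c -> exists2 C, 0 <= C &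
  forall x, 1 <= x -> x ^+ n * expR (- (c * x ^+ 2)) <= C / x.
Proof.
move=> c0; exists (n.+1`!%:R / c ^+ n.+1) => [|x x1].
  by rewrite divr_ge0 ?exprn_ge0 // ltW.
have x0 : 0 < x by exact: lt_le_trans x1.
rewrite expRN ler_pdivlMr // mulrAC -exprSr ler_pdivrMr ?expR_gt0 //.
have y0 : 0 <= c * x ^+ 2 by rewrite mulr_ge0 ?sqr_ge0 // ltW.
have h := @expR_ge1Dxn R (c * x ^+ 2) n y0.
have f0 : 0 < n.+1`!%:R :> R by rewrite ltr0n fact_gt0.
apply: (@le_trans _ _ (n.+1`!%:R / c ^+ n.+1 * ((c * x ^+ 2) ^+ n.+1 / n.+1`!%:R))).
  have -> : n.+1`!%:R / c ^+ n.+1 * ((c * x ^+ 2) ^+ n.+1 / n.+1`!%:R)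
      = (x ^+ 2) ^+ n.+1.
    by rewrite exprMn; field; rewrite !gt_eqF ?exprn_gt0.
  rewrite expr2 exprMn.
  by rewrite ler_peMr ?exprn_ge0 ?exprn_ege1 // ltW.
rewrite ler_pM2l ?divr_gt0 ?exprn_gt0 //; apply: le_trans h.
by rewrite lerDr.
Qed.

Lemma cvg_div_log_scale (C : R) : C / L M @[M --> \oo] --> 0.
Proof.
apply/cvgr0Pnorm_le => e e0.
near=> M; have [M0 LM] : (0 < M)%N /\ 1 + `|C| / e <= L M.
  by near: M; exact: log_scale_large.
have L0 : 0 < L M by apply: lt_le_trans LM; rewrite ltr_wpDr // divr_ge0 // ltW.
have -> : `|C / L M| = `|C| / L M by rewrite normrM normfV (ger0_norm (ltW L0)).
rewrite ler_pdivrMr // mulrC -ler_pdivrMr //.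
by apply: le_trans LM; rewrite lerDr.
Unshelve. all: by end_near. Qed.

End log_scale.

(** * Calculus of high-probability statements *)

Section high_probability.
Context (R : realType) (d : nat -> measure_display)
  (T : forall M, measurableType (d M)) (P : forall M, probability (T M) R).
Local Notation whp := (@with_high_probability R d T P).
Local Notation L := (@log_scale R).

Lemma whp_impl (Q1 Q2 : forall M, T M -> Prop) :
  (\forall M \near \oo, forall w, Q1 M w -> Q2 M w) -> whp Q1 -> whp Q2.
Proof.
move=> Q12 [N [mN PN NQ]]; exists N; split => //.
by near=> M => w Nw; apply: (near Q12 M) => //; exact: (near NQ M).
Unshelve. all: by end_near. Qed.

Lemma whp_and (Q1 Q2 : forall M, T M -> Prop) :
  whp Q1 -> whp Q2 -> whp (fun M w => Q1 M w /\ Q2 M w).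
Proof.
move=> [N1 [mN1 PN1 NQ1]] [N2 [mN2 PN2 NQ2]].
exists (fun M => N1 M `|` N2 M); split.
- by move=> M; exact: measurableU.
- apply: (@squeeze_cvge _ _ _ _ (cst 0%E) _ (fun M => P M (N1 M) + P M (N2 M))%E).
  + by near=> M; rewrite measure_ge0 measureU2.
  + exact: cvg_cst.
  + by rewrite -[X in _ --> X]adde0; apply: cvgeD.
- near=> M => w /not_orP[n1 n2].
  by split; [exact: (near NQ1 M) | exact: (near NQ2 M)].
Unshelve. all: by end_near. Qed.

Lemma whp_bounded_forall n (Q : nat -> forall M, T M -> Prop) :
  (forall k, (k < n)%N -> whp (Q k)) ->
  whp (fun M w => forall k, (k < n)%N -> Q k M w).
Proof.
elim: n => [_|n IH h].
  exists (fun=> set0); split => //; last by near=> M.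
  by under eq_fun do rewrite measure0; exact: cvg_cst.
have h1 := IH (fun k kn => h k (ltnW kn)); have h2 := h n (ltnSn n).
apply: whp_impl (whp_and h1 h2); near=> M => w [a b] k.
by rewrite ltnS leq_eqVlt => /orP[/eqP->//|/a].
Unshelve. all: by end_near. Qed.

Lemma whp_rate (N : forall M, set (T M)) (C : R) (Q : forall M, T M -> Prop) :
  (\forall M \near \oo, forall w, ~ N M w -> Q M w) ->
  (forall M, measurable (N M)) ->
  (\forall M \near \oo, (P M (N M) <= (C / L M)%:E)%E) ->
  whp Q.
Proof.
move=> NQ mN PN; exists N; split => //.
apply: (@squeeze_cvge _ _ _ _ (cst 0%E) _ (fun M => (C / L M)%:E)).
- by near=> M; rewrite measure_ge0 /=; near: M.
- exact: cvg_cst.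
- by apply: cvg_EFin; [near=> M | exact: cvg_div_log_scale].
Unshelve. all: by end_near. Qed.

End high_probability.

(** * Extremes, counts and empirical means of the sample *)

Section iid_high_probability.
Context (R : realType) (d : nat -> measure_display)
  (T : forall M, measurableType (d M)) (P : forall M, probability (T M) R)
  (V : forall M : nat, 'I_M -> {RV (P M) >-> R}).
Hypothesis hV : forall M : nat, (2 <= M)%N -> iid_standard_gaussian (@V M).
Local Notation whp := (@with_high_probability R d T P).
Local Notation L := (@log_scale R).
Local Notation gamma := (@normal_prob R 0 1).

Let mpre M (i : 'I_M) (B : set R) : measurable B -> measurable (V i @^-1` B).
Proof. exact: measurable_preimage. Qed.

Lemma large_index (A : R) : \forall M \near \oo, (2 <= M)%N /\ A <= L M.
Proof.
near=> M; split; first by near: M; exact: nbhs_infty_ge.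
have [] : (0 < M)%N /\ A <= L M by near: M; exact: log_scale_large.
by [].
Unshelve. all: by end_near. Qed.

(** As [c > 1], the tail [M ^ (- c ^ 2)] beats the factor [M] of the union bound. *)
Lemma whp_max (c : R) : 1 < c ->
  whp (fun M w => forall i, `|@V M i w| <= c * L M).
Proof.
move=> c1; have c'0 : 0 < (c ^+ 2 - 1) / 2 by nra.
have [C C0 hC] := exp_decay 0 c'0.
apply: (@whp_rate _ _ _ P (fun M =>
  [set w | exists i, (@V M i @^-1` [set x | c * L M < `|x|]) w]) (2 * C)).
- near=> M => w Nw i; rewrite leNgt; apply/negP => h; apply: Nw; by exists i.
- move=> M; apply: measurable_exists => i; apply: mpre; exact: measurable_gt_norm.
near=> M; have [M2 L1] : (2 <= M)%N /\ 1 <= L M by near: M; exact: large_index.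
have M0 : (0 < M)%N by exact: ltnW.
have t0 : 0 <= c * L M by nra.
apply: le_trans (iid_exists_le (hV M2) (measurable_gt_norm _) (normal_prob_gt_norm t0)) _.
rewrite lee_fin mulrCA -mulrA ler_pM2l // (natr_log_scale R M0) -expRD.
have := hC _ L1; rewrite expr0 mul1r; apply: le_trans; rewrite ler_expR; lra.
Unshelve. all: by end_near. Qed.

(** The expected number of hits is at least a constant times [L * M ^ (1 - m ^ 2)]. As [m < 1], it
    is at least of order [L], and the probability of no hit is at most the inverse of that. *)
Lemma whp_hit (a b m : R) : a < b -> - m <= a -> b <= m -> 0 <= m -> m < 1 ->
  whp (fun M w => exists i, a * L M <= @V M i w <= b * L M).
Proof.
move=> ab ma bm m0 m1.
pose c := (b - a) * normal_peak 1 : R.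
have c0 : 0 < c by rewrite mulr_gt0 ?subr_gt0 // normal_peak_gt0 // oner_eq0.
apply: (@whp_rate _ _ _ P (fun M =>
  [set w | forall i, ~ `[a * L M, b * L M]%classic (@V M i w)]) c^-1).
- near=> M => w Nw; apply: contrapT => h; apply: Nw => i hi; apply: h; exists i.
  by move: hi; rewrite /= in_itv.
- move=> M.
  rewrite (_ : mkset _ = ~` [set w | exists i, (@V M i @^-1` `[a * L M, b * L M]%classic) w]).
    by apply: measurableC; apply: measurable_exists => i; apply: mpre.
  apply/seteqP; split => w /=; first by move=> h [k]; exact: h.
  by move=> h i hi; apply: h; exists i.
near=> M; have [M2 L1] : (2 <= M)%N /\ 1 <= L M by near: M; exact: large_index.
have M0 : (0 < M)%N by exact: ltnW.
have L0 : 0 < L M by lra.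
pose p := (b * L M - a * L M) * (normal_peak 1 * expR (- (m * L M) ^+ 2 / 2)).
have p0 : 0 <= p.
  by rewrite mulr_ge0 ?mulr_ge0 ?expR_ge0 ?normal_peak_ge0 // subr_ge0 ler_wpM2r // ltW.
have pB : (p%:E <= gamma `[(a * L M)%R, (b * L M)%R])%E.
  apply: normal_prob_itv_ge; first by rewrite ler_wpM2r // ltW.
    by rewrite -mulNr ler_wpM2r // ltW.
  by rewrite ler_wpM2r // ltW.
apply: le_trans (iid_none_le (hV M2) _ p0 pB) _; first exact: measurable_itv.
have cL0 : 0 < c * L M by exact: mulr_gt0.
have pM : c * L M <= p * M%:R.
  have -> : p * M%:R = c * L M * expR (- (m * L M) ^+ 2 / 2 + L M ^+ 2 / 2).
    by rewrite /p /c (natr_log_scale R M0) expRD; ring.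
  rewrite ler_peMr ?(ltW cL0) //.
  rewrite -[leLHS]expR0 ler_expR exprMn.
  have m2 : 0 <= 1 - m ^+ 2 by nra.
  have := mulr_ge0 m2 (sqr_ge0 (L M)); lra.
rewrite lee_fin expRN -invfM lef_pV2 ?posrE ?expR_gt0 //.
apply: le_trans pM _; apply: le_trans (expR_ge1Dx _); lra.
Unshelve. all: by end_near. Qed.

Let indic_sum M (B : set R) (b : pred R) w : (forall x, B x <-> b x) ->
  \sum_(i < M) (b (@V M i w))%:R = \sum_(i < M) \1_B (@V M i w) :> R.
Proof.
move=> Bb; apply: eq_bigr => i _; rewrite indicE; congr (nat_of_bool _)%:R.
by apply/idP/idP; rewrite inE => /Bb.
Qed.

Let measurable_count M (B : set R) (t : R) : measurable B ->
  measurable [set w | (t <= \sum_i \1_B (@V M i w))%R].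
Proof.
move=> mB; rewrite -[X in measurable X]setTI.
apply: (@measurable_fun_le _ _ R setT (cst t)) => //.
apply: measurable_sum => i; apply: measurableT_comp => //.
Qed.

Lemma whp_bulk (b q : R) : 0 < b -> 0 < q ->
  whp (fun M w => M%:R^-1 * \sum_i (b * L M < `|@V M i w|)%R%:R <= q).
Proof.
move=> b0 q0; have b20 : 0 < b ^+ 2 / 2 by rewrite divr_gt0 ?exprn_gt0.
have [C C0 hC] := exp_decay 0 b20.
apply: (@whp_rate _ _ _ P (fun M =>
  [set w | (M%:R * q <= \sum_i \1_[set x : R | b * L M < `|x|] (@V M i w))%R]) (2 * C / q)).
- near=> M; have [M2 L1] : (2 <= M)%N /\ 1 <= L M by near: M; exact: large_index.
  have M0 : 0 < M%:R :> R by rewrite ltr0n ltnW.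
  move=> w /= /negP; rewrite -ltNge => /ltW h.
  rewrite ler_pdivrMl //; apply: le_trans h.
  by rewrite (@indic_sum _ [set x : R | b * L M < `|x|] (fun x => b * L M < `|x|)).
- by move=> M; apply: measurable_count; exact: measurable_gt_norm.
near=> M; have [M2 L1] : (2 <= M)%N /\ 1 <= L M by near: M; exact: large_index.
have M0 : 0 < M%:R :> R by rewrite ltr0n ltnW.
have t0 : 0 <= b * L M by nra.
apply: le_trans (iid_count_le (hV M2) (measurable_gt_norm _) (normal_prob_gt_norm t0) _) _.
  exact: mulr_gt0.
rewrite lee_fin -mulf_div divff ?gt_eqF // mul1r.
rewrite [leRHS]mulrAC ler_pM2r ?invr_gt0 // -[leRHS]mulrA ler_pM2l //.
have := hC _ L1; rewrite expr0 mul1r; apply: le_trans; rewrite ler_expR; lra.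
Unshelve. all: by end_near. Qed.

(** The threshold is the square of the bound [M ^ (1 - c ^ 2)] on the expected count, so Markov's
    inequality leaves the inverse of that bound. *)
Lemma whp_tail_count (c : R) : 0 <= c -> c < 1 ->
  whp (fun M w => \sum_i (@V M i w <= - (c * L M))%R%:R <= expR ((1 - c ^+ 2) * L M ^+ 2)).
Proof.
move=> c0 c1; have e0 : 0 < (1 - c ^+ 2) / 2 by nra.
have [C C0 hC] := exp_decay 0 e0.
apply: (@whp_rate _ _ _ P (fun M =>
  [set w | (expR ((1 - c ^+ 2) * L M ^+ 2) <=
     \sum_i \1_[set x : R | x <= - (c * L M)] (@V M i w))%R]) (C)).
- near=> M => w /= /negP; rewrite -ltNge => /ltW h; apply: le_trans h.
  by rewrite (@indic_sum _ [set x : R | x <= - (c * L M)] (fun x => x <= - (c * L M))).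
- by move=> M; apply: measurable_count; exact: measurable_le_cst.
near=> M; have [M2 L1] : (2 <= M)%N /\ 1 <= L M by near: M; exact: large_index.
have M0 : (0 < M)%N by exact: ltnW.
have t0 : 0 <= c * L M by nra.
have /le_trans := iid_count_le (hV M2) (measurable_le_cst _)
  (normal_prob_le_tail t0) (expR_gt0 ((1 - c ^+ 2) * L M ^+ 2)).
apply.
rewrite lee_fin (natr_log_scale R M0) -expRN -!expRD.
have := hC _ L1; rewrite expr0 mul1r; apply: le_trans; rewrite ler_expR; lra.
Unshelve. all: by end_near. Qed.

(** The expected number of pairs below [- c * L] is of order [exp ((1 - c ^ 2) * L ^ 2)]; a
    separation with twice this exponent beats it. The cutoff [- 2 * L], harmless by [whp_max],
    bounds the number of cells. *)
Lemma whp_gap (c : R) : 0 <= c -> c < 1 ->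
  whp (fun M w => forall i j, i != j ->
    - (2 * L M) <= @V M i w <= - (c * L M) -> - (2 * L M) <= @V M j w <= - (c * L M) ->
    expR (- (2 * (1 - c ^+ 2) * L M ^+ 2)) <= `|@V M i w - @V M j w|).
Proof.
move=> c0 c1; have e0 : 0 < 1 - c ^+ 2 by nra.
have [C C0 hC] := exp_decay 1 e0.
pose s M := expR (- (2 * (1 - c ^+ 2) * L M ^+ 2)).
(* An exceptional set is chosen for every [M]; for [M < 2], where the variables are arbitrary, it is
   empty. *)
have /(_ _)/cid hN M : exists N : set (T M), measurable N /\ ((2 <= M)%N ->
    (P M N <= (4 * M%:R ^+ 2 * s M * (2 * L M + s M) * expR (- (c * L M) ^+ 2))%:E)%E /\
    forall w, ~ N w -> forall i j, i != j ->
      - (2 * L M) <= @V M i w <= - (c * L M) -> - (2 * L M) <= @V M j w <= - (c * L M) ->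
      s M <= `|@V M i w - @V M j w|).
  have [M2|M2] := leqP 2 M; last by exists set0; split.
  have [N [mN PN h]] := @iid_gap _ _ _ _ _ _ (hV M2) (c * L M) (s M) (2 * L M)
    (mulr_ge0 c0 (log_scale_ge0 R M)) (expR_gt0 _) (mulr_ge0 (ler0n _ 2) (log_scale_ge0 R M)).
  by exists N; split.
apply: (@whp_rate _ _ _ P (fun M => sval (hN M)) (12 * C)).
- near=> M; have [M2 L1] : (2 <= M)%N /\ 1 <= L M by near: M; exact: large_index.
  by move=> w; case: (hN M) => N /= [_ /(_ M2)[_]]; apply.
- by move=> M; case: (hN M) => N [].
near=> M; have [M2 L1] : (2 <= M)%N /\ 1 <= L M by near: M; exact: large_index.
have M0 : (0 < M)%N by exact: ltnW.
case: (hN M) => N /= [_ /(_ M2)[PN _]]; apply: le_trans PN _; rewrite lee_fin.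
have s1 : s M <= 1.
  rewrite -[leRHS]expR0 ler_expR; have := mulr_ge0 (ltW e0) (sqr_ge0 (L M)); lra.
have -> : 4 * M%:R ^+ 2 * s M * (2 * L M + s M) * expR (- (c * L M) ^+ 2) =
    4 * (2 * L M + s M) * expR (- ((1 - c ^+ 2) * L M ^+ 2)).
  rewrite (_ : expR (- ((1 - c ^+ 2) * L M ^+ 2)) =
     M%:R ^+ 2 * s M * expR (- (c * L M) ^+ 2)); first by ring.
  by rewrite (natr_log_scale R M0) -expRM_natl /s -!expRD; congr expR; field.
apply: (@le_trans _ _ (12 * (L M ^+ 1 * expR (- ((1 - c ^+ 2) * L M ^+ 2))))).
  rewrite expr1 mulrA ler_pM2r ?expR_gt0 //; lra.
by rewrite -mulrA ler_pM2l //; exact: hC.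
Unshelve. all: by end_near. Qed.

(** The variance of the mean is of order [M^-1], which is exponentially small in [L ^ 2]; hence any
    power of [1 / L] is an admissible deviation. With [a = lambda] it is a power of [kappa]. *)
Lemma whp_mean (f : R -> R) (C : R) (a : R) k : 0 < a ->
  measurable_fun setT f -> (forall x, `|f x| <= C * (1 + x ^+ 4)) ->
  (\int[gamma]_x f x)%R = 0 ->
  whp (fun M w => `|M%:R^-1 * \sum_i f (@V M i w)| <= (a / L M) ^+ k).
Proof.
move=> a0 mf fC f0.
have mf2 : measurable_fun setT (fun x => f x ^+ 2) by exact: measurable_funX.
have C0 : 0 <= C.
  by have := fC 0; rewrite expr0n /= addr0 mulr1; apply: le_trans.
have intf : gamma.-integrable setT (EFin \o f).
  apply: (@normal_integrable _ _ (2 * C)) => // x; apply: le_trans (fC x) _.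
  rewrite -mulrA mulrCA ler_wpM2l //.
  by have := sqr_ge0 (x ^+ 4 - 1); rewrite (exprD x 4 4); nra.
have intf2 : gamma.-integrable setT (EFin \o (fun x => f x ^+ 2)).
  apply: (@normal_integrable _ _ (2 * C ^+ 2)) => // x.
  rewrite normrX; apply: (@le_trans _ _ ((C * (1 + x ^+ 4)) ^+ 2)).
    by rewrite lerXn2r ?nnegrE // (le_trans _ (fC x)).
  rewrite exprMn [leRHS](_ : _ = C ^+ 2 * (2 * (1 + x ^+ 8))); last by ring.
  rewrite ler_wpM2l ?sqr_ge0 //.
  by have := sqr_ge0 (x ^+ 4 - 1); rewrite (exprD x 4 4); nra.
set K := (\int[gamma]_x (f x ^+ 2))%R.
have K0 : 0 <= K by apply: Rintegral_ge0 => x _; exact: sqr_ge0.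
have half0 : 0 < 1 / 2 :> R by [].
have [D D0 hD] := exp_decay (2 * k) half0.
apply: (@whp_rate _ _ _ P (fun M => [set w | (M%:R * (a / L M) ^+ k <=
    `|\sum_i f (@V M i w)|)%R]) (K / a ^+ (2 * k) * D)).
- near=> M; have [M2 L1] : (2 <= M)%N /\ 1 <= L M by near: M; exact: large_index.
  have M0 : 0 < M%:R :> R by rewrite ltr0n ltnW.
  move=> w /= /negP; rewrite -ltNge => /ltW h.
  by rewrite normrM ger0_norm ?invr_ge0 ?ler0n // ler_pdivrMl.
- move=> M; rewrite -[X in measurable X]setTI.
  apply: (@measurable_fun_le _ _ R setT (cst _)) => //.
  apply: measurableT_comp => //; apply: measurable_sum => i.
  apply: measurableT_comp => //; exact: (measurable_funPT (@V M i)).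
near=> M; have [M2 L1] : (2 <= M)%N /\ 1 <= L M by near: M; exact: large_index.
have M0 : (0 < M)%N by exact: ltnW.
have M0' : 0 < M%:R :> R by rewrite ltr0n.
have L0 : 0 < L M by lra.
have t0 : 0 < M%:R * (a / L M) ^+ k by rewrite mulr_gt0 // exprn_gt0 // divr_gt0.
apply: le_trans (iid_mean_deviation (hV M2) mf intf f0 intf2 erefl t0) _.
rewrite lee_fin -/K.
have -> : M%:R * K / (M%:R * (a / L M) ^+ k) ^+ 2 =
    K / a ^+ (2 * k) * (L M ^+ (2 * k) * M%:R^-1).
  rewrite exprMn -[(_ ^+ k) ^+ 2]exprM mulnC expr_div_n; field.
  by rewrite !gt_eqF ?exprn_gt0.
rewrite -[leRHS]mulrA ler_wpM2l ?divr_ge0 ?exprn_ge0 ?(ltW a0) //.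
rewrite (natr_log_scale R M0) -expRN.
have := hD _ L1; apply: le_trans; rewrite ler_wpM2l ?exprn_ge0 ?(ltW L0) // ler_expR; lra.
Unshelve. all: by end_near. Qed.

End iid_high_probability.

(** * The random spectrum *)

Section random_energy.
Context (R : realType) (d : nat -> measure_display)
  (T : forall M, measurableType (d M)) (P : forall M, probability (T M) R)
  (V : forall M : nat, 'I_M -> {RV (P M) >-> R}).
Hypothesis hV : forall M : nat, (2 <= M)%N -> iid_standard_gaussian (@V M).
Variable lambda : R.
Hypothesis lambda0 : 0 < lambda.
Local Notation whp := (@with_high_probability R d T P).
Local Notation L := (@log_scale R).
Local Notation gamma := (@normal_prob R 0 1).
Local Notation kap := (kappa lambda).

Definition energy_level M (w : T M) (i : 'I_M) : R := kap M * @V M i w.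
Local Notation u := energy_level.
Local Notation E0 := (fun M w => min_spectrum (mean_field (@u M w))).

Lemma kappaE M : kap M = lambda / L M. Proof. by []. Qed.

Lemma kappa_small (e : R) : 0 < e ->
  \forall M \near \oo, [/\ (2 <= M)%N, 0 < L M, 0 < kap M & kap M <= e].
Proof.
move=> e0; near=> M.
have [M2 LM] : (2 <= M)%N /\ 1 + lambda / e <= L M by near: M; exact: large_index.
have L0 : 0 < L M by apply: lt_le_trans LM; rewrite ltr_wpDr // divr_ge0 // ltW.
split => //; first by rewrite divr_gt0.
by rewrite kappaE ler_pdivrMr // mulrC -ler_pdivrMr // (le_trans _ LM) // lerDr.
Unshelve. all: by end_near. Qed.

Lemma gt_norm_energy M (w : T M) i (t : R) : 0 < L M ->
  (t < `|u w i|) = (t / lambda * L M < `|@V M i w|).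
Proof.
move=> L0; rewrite /energy_level normrM gtr0_norm ?divr_gt0 // kappaE.
rewrite -[RHS](ltr_pM2l (_ : 0 < lambda / L M)) ?divr_gt0 //; congr (_ < _).
by field; rewrite !gt_eqF.
Qed.

Lemma whp_energy_norm (b : R) : lambda < b ->
  whp (fun M w => forall i, `|u w i| <= b).
Proof.
move=> lb; have c1 : 1 < b / lambda by rewrite ltr_pdivlMr // mul1r.
apply: whp_impl (whp_max hV c1).
near=> M => w h i; have [_ L0 _ _] : [/\ (2 <= M)%N, 0 < L M, 0 < kap M & kap M <= 1].
  by near: M; exact: kappa_small.
by rewrite leNgt gt_norm_energy // -leNgt.
Unshelve. all: by end_near. Qed.

Lemma whp_energy_bulk (t q : R) : 0 < t -> 0 < q ->
  whp (fun M w => M%:R^-1 * \sum_i (t < `|u w i|)%R%:R <= q).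
Proof.
move=> t0 q0; apply: whp_impl (whp_bulk hV (divr_gt0 t0 lambda0) q0).
near=> M => w; have [_ L0 _ _] : [/\ (2 <= M)%N, 0 < L M, 0 < kap M & kap M <= 1].
  by near: M; exact: kappa_small.
by under eq_bigr do rewrite -gt_norm_energy //.
Unshelve. all: by end_near. Qed.

Lemma whp_energy_ge (m e : R) : 1 <= m -> lambda <= m -> 0 < e ->
  whp (fun M w => - m - e <= E0 M w).
Proof.
move=> m1 lm e0; have e20 : 0 < e / 2 by rewrite divr_gt0.
have i1 : (1 + e / 2)^-1 < 1 by rewrite invf_lt1; lra.
(* With this [q] the outliers use half of the room that the bulk term leaves below 1. *)
pose q := (1 - (1 + e / 2)^-1) * (e / 4).
have q0 : 0 < q by rewrite mulr_gt0 ?subr_gt0 // divr_gt0.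
have lb : lambda < m + e / 2 by lra.
apply: whp_impl (whp_and (whp_energy_norm lb) (whp_energy_bulk e20 q0)).
near=> M => w [h1 h2]; have [M2 _ _ _] : [/\ (2 <= M)%N, 0 < L M, 0 < kap M & kap M <= 1].
  by near: M; exact: kappa_small.
apply: min_spectrum_ge_bulk => //; first exact: ltnW.
  by move=> i; have := h1 i; rewrite ler_norml => /andP[]; lra.
have : M%:R^-1 * (\sum_i (e / 2 < `|u w i|)%R%:R) * (2 / e) <= q * (2 / e).
  by rewrite ler_wpM2r // divr_ge0 // ltW.
have -> : q * (2 / e) = (1 - (1 + e / 2)^-1) / 2.
  by rewrite /q; set z := (1 + e / 2)^-1; field; rewrite gt_eqF.
lra.
Unshelve. all: by end_near. Qed.

Let m4 : R := (\int[gamma]_x (x ^+ 4))%R.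

Lemma whp_energy_moments :
  whp (fun M w => [/\ `|M%:R^-1 * \sum_i u w i| <= kap M ^+ 4,
    `|M%:R^-1 * (\sum_i u w i ^+ 2) - kap M ^+ 2| <= kap M ^+ 4,
    `|M%:R^-1 * \sum_i u w i ^+ 3| <= kap M ^+ 4 &
    M%:R^-1 * (\sum_i u w i ^+ 4) <= (1 + m4) * kap M ^+ 4]).
Proof.
have cent n c : (n <= 4)%N -> (\int[gamma]_x (x ^+ n))%R = c ->
    (\int[gamma]_x (x ^+ n - c))%R = 0.
  move=> n4 <-; rewrite RintegralB //.
  - by rewrite Rintegral_cst // [X in fine X]probability_setT mulr1 subrr.
  - by apply: normal_integrable_exp; exact: leq_trans n4 _.
  - exact: finite_measure_integrable_cst.
have mexp n c : measurable_fun setT (fun x : R => x ^+ n - c).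
  by apply: measurable_funB => //; exact: measurable_funX.
have bexp n c (x : R) : (n <= 4)%N -> `|x ^+ n - c| <= (1 + `|c|) * (1 + x ^+ 4).
  move=> n4; apply: le_trans (ler_normB _ _) _.
  have x40 : 0 <= x ^+ 4 by exact: exprn_even_ge0.
  have : `|x ^+ n| <= 1 + x ^+ 4 by rewrite normrX normX_le_even.
  have := mulr_ge0 (normr_ge0 c) x40; lra.
have mean n c k : (n <= 4)%N -> (\int[gamma]_x (x ^+ n))%R = c ->
    whp (fun M w => `|M%:R^-1 * (\sum_i u w i ^+ n) - c * kap M ^+ n| <= kap M ^+ (n + k)).
  move=> n4 ce.
  apply: whp_impl (whp_mean hV k lambda0 (mexp n c) (fun x => bexp n c x n4) (cent n c n4 ce)).
  near=> M => w; have [M2 L0 k0 _] : [/\ (2 <= M)%N, 0 < L M, 0 < kap M & kap M <= 1].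
    by near: M; exact: kappa_small.
  have M0 : M%:R != 0 :> R by rewrite pnatr_eq0 -lt0n ltnW.
  rewrite -kappaE => h; rewrite exprD.
  have -> : M%:R^-1 * (\sum_i u w i ^+ n) - c * kap M ^+ n
      = kap M ^+ n * (M%:R^-1 * \sum_i (@V M i w ^+ n - c)).
    rewrite sumrB sumr_const card_ord -[c *+ M]mulr_natl [_ * (_ - _)]mulrBr mulKf //.
    rewrite mulrBr [c * _]mulrC; congr (_ - _); rewrite mulrCA; congr (_ * _).
    by rewrite mulr_sumr; apply: eq_bigr => i _; rewrite /energy_level exprMn.
  rewrite normrM ger0_norm ?exprn_ge0 ?(ltW k0) // ler_wpM2l // exprn_ge0 ?(ltW k0) //.
(* The scaling of [u] gives [kappa ^ n]; the remaining power [k = 4 - n] is taken from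
   [whp_mean]. *)
have w1 := mean 1%N 0 3%N isT (@normal_moment_odd R 1 isT isT).
have w2 := mean 2%N 1 2%N isT (normal_moment2 R).
have w3 := mean 3%N 0 1%N isT (@normal_moment_odd R 3 isT isT).
have w4 := mean 4%N m4 0%N isT erefl.
apply: whp_impl (whp_and (whp_and w1 w2) (whp_and w3 w4)); near=> M => w.
rewrite !mul0r !subr0 mul1r => -[[h1 h2] [h3 h4]]; split => //.
by move: h4; rewrite addn0 ler_norml => /andP[_]; lra.
Unshelve. all: by end_near. Qed.

Lemma whp_energy_le (e : R) : 0 < e -> whp (fun M w => E0 M w <= - 1 + e).
Proof.
move=> e0; apply: whp_impl whp_energy_moments.
have me : 0 < Num.min 1 e by rewrite lt_min ltr01.
near=> M => w [h1 _ _ _].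
have [M2 _ k0 ] : [/\ (2 <= M)%N, 0 < L M, 0 < kap M & kap M <= Num.min 1 e].
  by near: M; exact: kappa_small.
rewrite le_min => /andP[k1 ke].
have := min_spectrum_le_mean (ltnW M2) (u w).
have := le_trans (ler_norm _) h1.
have : kap M ^+ 4 <= kap M by rewrite exprSr ler_piMl ?exprn_ile1 ?(ltW k0).
lra.
Unshelve. all: by end_near. Qed.

Lemma whp_energy_perturbative : lambda < 1 -> exists C,
  whp (fun M w => `|E0 M w - (- 1 - kap M ^+ 2)| <= C * kap M ^+ 4).
Proof.
move=> l1; pose b := (1 + lambda) / 2.
have lb : lambda < b by rewrite /b; lra.
have b1 : b < 1 by rewrite /b; lra.
exists (perturbation_constant b (1 + m4)).
have r0 : 0 < Num.min 1 ((1 - b) / 2) by rewrite lt_min ltr01 /b; lra.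
apply: whp_impl (whp_and (whp_energy_norm lb) whp_energy_moments).
near=> M => w [h [h1 h2 h3 h4]].
have [M2 _ k0 ] : [/\ (2 <= M)%N, 0 < L M, 0 < kap M & kap M <= Num.min 1 ((1 - b) / 2)].
  by near: M; exact: kappa_small.
rewrite le_min => /andP[k1 ke].
apply: min_spectrum_perturbative => //; rewrite ?(ltW k0) //.
- exact: ltnW.
- exact: le_trans (ltW lambda0) (ltW lb).
- by rewrite addr_ge0 // Rintegral_ge0 // => x _; exact: exprn_even_ge0.
- by apply: le_trans ke; rewrite exprSr ler_piMl ?exprn_ile1 ?(ltW k0).
Unshelve. all: by end_near. Qed.

End random_energy.

Section random_spectrum.
Context (R : realType) (d : nat -> measure_display)
  (T : forall M, measurableType (d M)) (P : forall M, probability (T M) R)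
  (V : forall M : nat, 'I_M -> {RV (P M) >-> R}).
Hypothesis hV : forall M : nat, (2 <= M)%N -> iid_standard_gaussian (@V M).
Variable lambda : R.
Hypothesis lambda0 : 0 < lambda.
Local Notation whp := (@with_high_probability R d T P).
Local Notation L := (@log_scale R).
Local Notation kap := (kappa lambda).
Local Notation u := (energy_level V lambda).

Lemma energy_levelE M (w : T M) i : u w i = lambda * (@V M i w / L M).
Proof. by rewrite /energy_level kappaE; ring. Qed.

Lemma energy_level_itv M (w : T M) i a b : 0 < L M ->
  a * L M <= @V M i w <= b * L M -> lambda * a <= u w i <= lambda * b.
Proof.
by move=> L0; rewrite energy_levelE !ler_pM2l // ler_pdivlMr // ler_pdivrMr.
Qed.

(** Only interior grid points are allowed, since a cell on each side is wanted; at the ends of the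
    range the nearest one is still within distance 1. *)
Lemma near_grid_point (x : R) n : (0 < n)%N -> 0 <= x -> x <= (n.*2)%:R ->
  exists p, [/\ (p.+1 < n.*2)%N & `|x - p.+1%:R| <= 1].
Proof.
move=> n0 x0 xn; have /andP[t1 t2] := truncn_itv x0; set t := Num.truncn x in t1 t2.
have [h|h] := ltnP t.+1 n.*2.
  by exists t; split=> //; rewrite ler_norml; move: t2; rewrite -natr1 => t2;
    apply/andP; split; lra.
exists (n.*2 - 2)%N; have n2 : (1 < n.*2)%N by rewrite -[n in n.*2]prednK.
have e : (n.*2 - 2).+1 = n.*2.-1 by rewrite -subn1 -subSn.
rewrite e; split; first by rewrite prednK // ltnW.
have h1 : (n.*2)%:R = n.*2.-1%:R + 1 :> R by rewrite natr1 prednK // ltnW.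
have h2 : n.*2.-1%:R <= t%:R :> R by rewrite ler_nat -ltnS prednK // ltnW.
rewrite ler_norml; apply/andP; split; lra.
Qed.

(** Values in the two cells adjacent to a grid point feed [mean_field_pair]. The number of cells
    depends on [lambda] and [e] only, so finitely many hits are required. *)
Lemma whp_spectrum_covers (e : R) : 0 < e ->
  whp (fun M w => forall y, - lambda <= y <= lambda ->
    exists2 E, spectrum (mean_field (u w)) E & `|y - E| <= e).
Proof.
move=> e0; pose n := (Num.truncn (2 * lambda / e)).+1.
have hn : 2 * lambda / e <= n%:R by apply: ltW; exact: truncnS_gt.
have n0 : 0 < n%:R :> R by rewrite ltr0n.
pose v : R := n%:R^-1; have v0 : 0 < v by rewrite invr_gt0.
have nv : n%:R * v = 1 by rewrite mulfV // gt_eqF.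
have v1 : v <= 1 by rewrite invf_le1 // ler1n.
have ve : 2 * lambda * v <= e.
  by rewrite ler_pdivrMr // [e * _]mulrC -ler_pdivrMr.
(* Only the middle half of a cell is used: values from different cells are then distinct, and all
   windows stay within [1 - v / 4] of 0, as [whp_hit] demands. *)
pose a (q : nat) : R := - 1 + (q%:R + 1 / 4) * v.
pose b (q : nat) : R := - 1 + (q%:R + 3 / 4) * v.
have hit q : (q < n.*2)%N -> whp (fun M w => exists i, a q * L M <= @V M i w <= b q * L M).
  move=> qn; have qn' : (q%:R + 1) * v <= 2.
    apply: (@le_trans _ _ ((n.*2)%:R * v)); first by rewrite ler_pM2r // natr1 ler_nat.
    by rewrite -muln2 natrM mulrAC nv mul1r.
  have qv : 0 <= q%:R * v by rewrite mulr_ge0 // ltW.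
  by apply: (whp_hit hV (m := 1 - v / 4)); rewrite /a /b; lra.
apply: whp_impl (whp_bounded_forall hit); near=> M => w hits y ylam.
have [M2 L0 k0 _] : [/\ (2 <= M)%N, 0 < L M, 0 < kap M & kap M <= 1].
  by near: M; exact: kappa_small.
pose x := (y / lambda + 1) * n%:R.
have x0 : 0 <= x.
  rewrite mulr_ge0 ?(ltW n0) // -lerBlDr sub0r ler_pdivlMr // mulN1r.
  by case/andP: ylam.
have xn : x <= (n.*2)%:R.
  rewrite -muln2 mulnC natrM ler_pM2r // -lerBrDr ler_pdivrMr //.
  by case/andP: ylam => _; lra.
have [p [pn xp]] := near_grid_point (ltn0Sn _) x0 xn.
have [i hi] := hits p (ltnW pn); have [j hj] := hits p.+1 pn.
have /andP[i1 i2] := energy_level_itv L0 hi.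
have /andP[j1 j2] := energy_level_itv L0 hj.
have lv : 0 < lambda * v by exact: mulr_gt0.
have ij : i != j.
  apply/eqP => eij; rewrite eij in i2; have := le_trans j1 i2.
  rewrite ler_pM2l // /a /b -natr1; apply/negP; rewrite -ltNge; lra.
pose m := lambda * (- 1 + p.+1%:R * v).
have ui : `|u w i - m| <= lambda * v * (3 / 4).
  rewrite ler_norml /m -natr1; apply/andP; split.
    by move: i1; rewrite /a; lra.
  by move: i2; rewrite /b; lra.
have uj : `|u w j - m| <= lambda * v * (3 / 4).
  rewrite ler_norml /m; apply/andP; split.
    by move: j1; rewrite /a; lra.
  by move: j2; rewrite /b; lra.
have [E sE Em] := mean_field_pair ij ui uj; exists E => //.
have ym : `|y - m| <= lambda * v.
  have -> : y - m = (x - p.+1%:R) * (lambda * v).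
    have -> : (x - p.+1%:R) * (lambda * v)
        = (y / lambda + 1) * lambda * (n%:R * v) - p.+1%:R * (lambda * v).
      by rewrite /x; ring.
    by rewrite nv /m; field; rewrite gt_eqF.
  by rewrite normrM [`|_ * v|]gtr0_norm // ler_piMl // ltW.
have -> : y - E = (y - m) - (E - m) by ring.
apply: le_trans (ler_normB _ _) _; lra.
Unshelve. all: by end_near. Qed.

Lemma sqrt_natr_log_scale M : (0 < M)%N -> Num.sqrt M%:R = expR (L M ^+ 2 / 4).
Proof.
move=> M0; rewrite (natr_log_scale R M0).
have -> : L M ^+ 2 / 2 = 2%:R * (L M ^+ 2 / 4) by field.
by rewrite expRM_natl sqrtr_sqr ger0_norm // expR_ge0.
Qed.

(* The gap [g] between the two lowest potential values is only needed to be at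
   least [kappa / sqrt M]. *)
Lemma whp_localized : 1 < lambda -> exists q, q < 1 /\
  whp (fun M w => exists i0 g, [/\ forall j, u w i0 <= u w j, 0 < g,
    kap M * Num.sqrt M%:R <= M%:R * g,
    forall i, i != i0 -> u w i0 + g <= u w i &
    M%:R^-1 * \sum_(i | i != i0) (u w i - u w i0)^-1 <= q]).
Proof.
move=> l1.
(* The bounds on [h] give [lambda * h <= (lambda - 1) / 4] and, through [e <= 4 * h],
   [e <= 1 / 8]. *)
pose h := Num.min ((lambda - 1) / (4 * lambda)) (1 / 32).
have h0 : 0 < h.
  by rewrite lt_min divr_gt0 ?subr_gt0 ?mulr_gt0 //= divr_gt0.
have h32 : h <= 1 / 32 by rewrite ge_min lexx orbT.
have hl : lambda * h <= (lambda - 1) / 4.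
  rewrite mulrC -ler_pdivlMr // ge_min; apply/orP; left.
  by rewrite le_eqVlt; apply/orP; left; apply/eqP; field; rewrite gt_eqF.
pose c := 1 - 2 * h; pose e := 1 - c ^+ 2.
have c0 : 0 <= c by rewrite /c; lra.
have c1 : c < 1 by rewrite /c; lra.
have e8 : e <= 1 / 8 by rewrite /e /c; have := sqr_ge0 h; nra.
pose p := lambda * (1 - h); pose t := - (lambda * c); pose dd := (lambda - 1) / 4.
have dd0 : 0 < dd by rewrite /dd; lra.
(* The minimum is at most [- p] and the bulk lies within [dd] of 0. Both [lambda - p] and [dd] are
   at most [(lambda - 1) / 4], so [p - dd >= (lambda + 1) / 2], which exceeds 1. *)
pose q0 := 2 / (lambda + 1).
have q01 : q0 < 1 by rewrite /q0 ltr_pdivrMr; lra.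
have tp : t + p = lambda * h by rewrite /t /p /c; ring.
have lh0 : 0 < lambda * h by exact: mulr_gt0.
have b1 : (p - dd)^-1 <= q0.
  rewrite /q0 -[leRHS]invrK invf_div lef_pV2 ?posrE ?divr_gt0 //; last lra.
    by rewrite /p /dd; lra.
  by rewrite /p /dd; lra.
(* The two other terms of [localized_sum] get a quarter of the room [1 - q0] each. *)
exists ((1 + q0) / 2); split; first lra.
pose q1 := (1 - q0) / 4 * (lambda * h).
have q10 : 0 < q1 by rewrite mulr_gt0 // divr_gt0 // subr_gt0.
have i8 : 0 < 1 / 8 :> R by [].
have [C C0 hC] := exp_decay 1 i8.
have whit : whp (fun M w => exists i, - (1 - h / 2) * L M <= @V M i w <= - (1 - h) * L M).
  by apply: (whp_hit hV (m := 1 - h / 2)); lra.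
have w2 : whp (fun M w => forall i, `|@V M i w| <= 2 * L M) by apply: whp_max => //; lra.
apply: whp_impl (whp_and (whp_and whit w2) (whp_and (whp_and (whp_tail_count hV c0 c1)
  (whp_gap hV c0 c1)) (whp_energy_bulk hV lambda0 dd0 q10))).
near=> M => w [[[k /andP[_ hk]] hmax] [[htail hgap] hbulk]].
(* The summand [h^-1] ensures [kappa <= lambda * h], so that [g] also separates [u i0] from the
   values above [t]; the last summand serves the edge term. *)
have [M2 LM] : (2 <= M)%N /\ 1 + h^-1 + C / lambda / ((1 - q0) / 4) <= L M.
  by near: M; exact: large_index.
have M0 : (0 < M)%N by exact: ltnW.
have M0' : 0 < M%:R :> R by rewrite ltr0n.
have hi0 : 0 < h^-1 by rewrite invr_gt0.
have r0 : 0 <= C / lambda / ((1 - q0) / 4) by rewrite !divr_ge0 ?subr_ge0 // ltW.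
have L1 : 1 <= L M by lra.
have L0 : 0 < L M by lra.
have k0 : 0 < kap M by rewrite divr_gt0.
pose s := expR (- (2 * e * L M ^+ 2)); have s0 : 0 < s by exact: expR_gt0.
pose g := kap M * s; have g0 : 0 < g by exact: mulr_gt0.
have L20 := sqr_ge0 (L M).
have e0 : 0 <= e by rewrite /e /c; nra.
have eL : e * L M ^+ 2 <= 1 / 8 * L M ^+ 2 by rewrite ler_wpM2r.
have s1 : s <= 1.
  by rewrite -[leRHS]expR0 ler_expR oppr_le0 -mulrA mulr_ge0 // mulr_ge0.
have [i0 ui0] := exists_argmin M0 (u w).
have tailE i : (u w i <= t) = (@V M i w <= - (c * L M)).
  rewrite energy_levelE /t -mulrN ler_pM2l // ler_pdivrMr //.
  by rewrite mulNr.
have uip : u w i0 <= - p.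
  apply: le_trans (ui0 k) _; rewrite energy_levelE /p -mulrN ler_pM2l //.
  by rewrite ler_pdivrMr.
have gap i j : i != j -> u w i <= t -> u w j <= t -> g <= `|u w i - u w j|.
  move=> ij; rewrite !tailE => ti tj.
  have := hgap i j ij; have := hmax i; have := hmax j; rewrite !ler_norml.
  move=> /andP[j1 _] /andP[i1 _]; rewrite i1 ti j1 tj => /(_ isT isT) hs.
  by rewrite /energy_level -mulrBr normrM (gtr0_norm k0) /g ler_pM2l.
have gh : g <= lambda * h.
  apply: (@le_trans _ _ (kap M)); first by rewrite /g ler_piMr // ltW.
  rewrite kappaE ler_pM2l // -[leRHS]invrK lef_pV2 ?posrE //; lra.
exists i0, g; split => //.
- rewrite (sqrt_natr_log_scale M0) (natr_log_scale R M0) /g [leRHS]mulrCA ler_pM2l //.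
  by rewrite /s -expRD ler_expR; lra.
- move=> i ii0; have [ti|ti] := leP (u w i) t; last by lra.
  have ti0 : u w i0 <= t by exact: le_trans (ui0 i) ti.
  by have := gap i i0 ii0 ti ti0; rewrite ger0_norm ?subr_ge0 //; lra.
have tp0 : 0 < t + p by rewrite tp.
have dp : dd < p by rewrite /p /dd; lra.
apply: le_trans (localized_sum M0 g0 tp0 dp uip gap ui0) _.
have b2 : M%:R^-1 * (\sum_i (dd < `|u w i|)%R%:R) / (t + p) <= (1 - q0) / 4.
  by rewrite ler_pdivrMr // tp.
have b3 : M%:R^-1 * (\sum_i (u w i <= t)%R%:R) / g <= (1 - q0) / 4.
  under eq_bigr do rewrite tailE.
  apply: (@le_trans _ _ (M%:R^-1 * expR (e * L M ^+ 2) / g)).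
    by rewrite ler_pM2r ?invr_gt0 // ler_pM2l ?invr_gt0.
  (* The count brings [e] and the gap [2 * e], so the exponent is [(- 1 / 2 + 3 * e) * L ^ 2], at
     most [- L ^ 2 / 8]. The factor [L] stems from the [kappa] in [g]. *)
  have -> : M%:R^-1 * expR (e * L M ^+ 2) / g =
      lambda^-1 * (L M * expR (- (L M ^+ 2 / 2) + e * L M ^+ 2 + 2 * e * L M ^+ 2)).
    rewrite !expRD expRN -(natr_log_scale R M0) /g /s expRN kappaE; field.
    by rewrite !gt_eqF ?expR_gt0.
  apply: (@le_trans _ _ (lambda^-1 * (L M ^+ 1 * expR (- (1 / 8 * L M ^+ 2))))).
    by rewrite ler_pM2l ?invr_gt0 // expr1 ler_pM2l // ler_expR; lra.
  apply: (@le_trans _ _ (lambda^-1 * (C / L M))).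
    by rewrite ler_pM2l ?invr_gt0 //; exact: hC.
  rewrite (_ : lambda^-1 * (C / L M) = C / lambda / L M); last by ring.
  have z0 : 0 < (1 - q0) / 4 by rewrite divr_gt0 // subr_gt0.
  by rewrite ler_pdivrMr // [leRHS]mulrC -ler_pdivrMr //; lra.
lra.
Unshelve. all: by end_near. Qed.

End random_spectrum.

(** * Hausdorff convergence of the spectrum *)

Lemma near_itv (R : realType) (x a e : R) : 0 <= a -> 0 <= e ->
  - a - e <= x <= a + e -> exists2 y, - a <= y <= a & `|x - y| <= e.
Proof.
move=> a0 e0 /andP[x1 x2]; have [h|h] := leP x (- a).
  by exists (- a); [apply/andP; split; lra | rewrite ler_norml; apply/andP; split; lra].
have [h'|h'] := leP a x.
  by exists a; [apply/andP; split; lra | rewrite ler_norml; apply/andP; split; lra].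
by exists x; [rewrite (ltW h) (ltW h') | rewrite subrr normr0].
Qed.

Section main.
Context (R : realType) (d : nat -> measure_display)
  (T : forall M, measurableType (d M)) (P : forall M, probability (T M) R)
  (V : forall M : nat, 'I_M -> {RV (P M) >-> R}).
Hypothesis hV : forall M : nat, (2 <= M)%N -> iid_standard_gaussian (@V M).
Variable lambda : R.
Hypothesis lambda0 : 0 < lambda.
Local Notation whp := (@with_high_probability R d T P).
Local Notation kap := (kappa lambda).
Local Notation u := (energy_level V lambda).

Lemma whp_hausdorff_le (e : R) : 0 < e ->
  whp (fun M w => hausdorff_distance (spectrum (mean_field (u w)))
                                     (limit_spectrum lambda) <= e).
Proof.
(* [- m] is the least point of the limit set in both regimes. *)
move=> e0; pose m := Num.max 1 lambda.
have m1 : 1 <= m by rewrite le_max lexx.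
have lm : lambda <= m by rewrite le_max lexx orbT.
have le : lambda < lambda + e by rewrite ltrDl.
apply: whp_impl (whp_and (whp_and (whp_energy_norm hV lambda0 le)
    (whp_energy_ge hV lambda0 m1 lm e0))
  (whp_and (whp_energy_le hV lambda0 e0) (whp_spectrum_covers hV lambda0 e0))).
near=> M => w [[hmax hge] [hle hcov]].
have [M2 _ _ _] : [/\ (2 <= M)%N, 0 < log_scale R M, 0 < kap M & kap M <= 1].
  by near: M; exact: kappa_small.
have M0 : (0 < M)%N by exact: ltnW.
have uab i : - (lambda + e) <= u w i <= lambda + e by have := hmax i; rewrite ler_norml.
have sE0 := min_spectrum_spectrum M0 (u w).
have E0u := min_spectrum_lt M0 (u w) (Ordinal M0).
have l0 := ltW lambda0.
have near1 : lambda < 1 -> `|min_spectrum (mean_field (u w)) - -1| <= e.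
  move=> l1; move: hge; rewrite /m max_l ?(ltW l1) // => hge.
  by rewrite ler_norml; apply/andP; split; lra.
apply: hausdorff_distance_le.
- by exists (min_spectrum (mean_field (u w))).
- exact: limit_spectrum_neq0.
- move=> E sE.
  have itv : - lambda - e <= E <= lambda + e ->
      exists2 y, limit_spectrum lambda y & `|E - y| <= e.
    move=> /(near_itv l0 (ltW e0))[y yl Ey]; exists y => //.
    by right; rewrite /= in_itv.
  case: (spectrum_mean_field_sub M0 uab sE) => [->|/andP[E1 E2]]; last first.
    by apply: itv; apply/andP; split; lra.
  have [l1|l1] := ltP lambda 1; first by exists (-1); [left|exact: near1].
  move: hge; rewrite /m max_r // => hge.
  have /andP[_ u2] := uab (Ordinal M0).
  have [y yl yE] := near_itv (x := min_spectrum (mean_field (u w))) l0 (ltW e0)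
    (introT andP (conj hge (le_trans (ltW E0u) u2))).
  by exists y => //; right; rewrite /= in_itv.
- move=> y [->|]; last by rewrite /= in_itv /=; exact: hcov.
  have [l1|l1] := ltP lambda 1.
    by exists (min_spectrum (mean_field (u w))) => //; rewrite distrC; exact: near1.
  (* For [lambda >= 1] the point [- 1] lies in the interval that the spectrum covers. *)
  by apply: hcov; apply/andP; split; lra.
Unshelve. all: by end_near. Qed.

(* [le_measure] needs the event itself to be measurable. *)
Lemma cvg_hausdorff_gt (e : R) : 0 < e ->
  P M [set w | e < hausdorff_distance (spectrum (hamiltonian lambda (fun i => @V M i w)))
                                      (limit_spectrum lambda)] @[M --> \oo] --> (0 : \bar R).
Proof.
move=> e0; have [N [mN PN hN]] := whp_hausdorff_le e0.
apply: (@squeeze_cvge _ _ _ _ (cst 0%E) _ (fun M => P M (N M))) => //; last exact: cvg_cst.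
near=> M; rewrite measure_ge0 /=.
have M0 : (0 < M)%N by near: M; exact: nbhs_infty_gt.
apply: le_measure; rewrite ?inE //.
  apply: (@measurable_hausdorff_gt R lambda _ _ M (fun i w => @V M i w)).
  - exact: M0.
  - by move=> i; exact: (measurable_funPT (@V M i)).
move=> w /= he; apply: contrapT => Nw; move: he; apply/negP; rewrite -leNgt.
by rewrite hamiltonianE; exact: (near hN M).
Unshelve. all: by end_near. Qed.

End main.

Theorem theorem2p1 (R : realType) (d : nat -> measure_display)
    (T : forall M : nat, measurableType (d M))
    (P : forall M : nat, probability (T M) R)
    (V : forall M : nat, 'I_M -> {RV (P M) >-> R})
    (hV : forall M : nat, (2 <= M)%N -> iid_standard_gaussian (@V M))
    (lambda : R) (hlambda : 0 < lambda) :
  let v := fun (M : nat) (w : T M) (i : 'I_M) => V M i w in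
  let H := fun (M : nat) (w : T M) => hamiltonian lambda (v M w) in
  let kV := fun (M : nat) (w : T M) => scaled_potential lambda (v M w) in
  (forall eps : R, 0 < eps ->
     P M [set w | eps < hausdorff_distance (spectrum (H M w))
                                           (limit_spectrum lambda)]
       @[M --> \oo] --> (0 : \bar R))
  /\
  (lambda < 1 ->
     prob_bigO P
       (fun M w => min_spectrum (H M w) - (-1 - kappa lambda M ^+ 2))
       (fun M => kappa lambda M ^+ 4))
  /\
  (1 < lambda ->
     prob_bigO P
       (fun M w => min_spectrum (H M w) - min_spectrum (kV M w))
       (fun M => M%:R^-1))
  /\
  (forall psi0 : forall M : nat, T M -> 'cV[R[i]]_M,
     (forall (M : nat) (w : T M), (2 <= M)%N ->
        ground_state (H M w) (psi0 M w)) ->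
     let ratio := fun (M : nat) (w : T M) =>
       norm2 (psi0 M w) / norm_infty (psi0 M w) in
     (lambda < 1 -> prob_bigTheta P ratio (fun M => Num.sqrt M%:R))
     /\
     (1 < lambda ->
        exists C : R, with_high_probability P
          (fun M w =>
             1 <= ratio M w <= 1 + C / (kappa lambda M * Num.sqrt M%:R)))).
Proof.
move=> v H kV.
have HE M w : H M w = mean_field (energy_level V lambda w) by exact: hamiltonianE.
split; first by move=> e e0; exact: (cvg_hausdorff_gt hV hlambda e0).
split.
  move=> l1; have [C hC] := whp_energy_perturbative hV hlambda l1.
  by exists C; apply: whp_impl hC; near=> M => w; rewrite HE.
split.
  move=> l1; have [q [q1 hq]] := whp_localized hV hlambda l1.
  exists (1 - q)^-1; apply: whp_impl hq.
  near=> M => w [i0 [g [ui0 g0 _ gap S]]].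
  have M0 : (0 < M)%N := leq_ltn_trans (leq0n i0) (ltn_ord i0).
  have gap' i : i != i0 -> energy_level V lambda w i0 < energy_level V lambda w i.
    by move=> /gap; apply: lt_le_trans; rewrite ltrDl.
  have h := localized_energy q1 gap' S.
  have hlt := min_spectrum_lt M0 (energy_level V lambda w) i0.
  rewrite HE /kV scaled_potentialE (min_spectrum_potential ui0).
  rewrite ltr0_norm ?subr_lt0 // opprB; apply: le_trans h _.
  by rewrite invfM mulrC.
move=> psi0 gs ratio; split => l1.
  pose b := (1 + lambda) / 2; have lb : lambda < b by rewrite /b; lra.
  have b1 : b < 1 by rewrite /b; lra.
  have b0 : 0 < b := lt_trans hlambda lb.
  (* From [u >= - b] and a ground energy of at most [- 1 + rho], the distance is at least
     [1 - b - rho = rho]; it is at most [2 * b + 1], since the ground energy is at least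
     [- b - 1]. *)
  pose rho := (1 - b) / 2; have rho0 : 0 < rho by rewrite /rho; lra.
  exists (rho / (2 * b + 1)), 1; split => //.
    by rewrite divr_gt0 //; lra.
  apply: whp_impl (whp_and (whp_energy_norm hV hlambda lb)
    (whp_energy_le hV hlambda rho0)).
  near=> M => w [hn he].
  have M2 : (2 <= M)%N by near: M; exact: nbhs_infty_ge.
  have M0 : (0 < M)%N by exact: ltnW.
  have := gs M w M2; rewrite HE mul1r; apply: delocalized_ratio => // i.
  have lo j : - b <= energy_level V lambda w j by have := hn j; rewrite ler_norml => /andP[].
  have := min_spectrum_ge M0 lo; have := lo i.
  have := hn i; rewrite ler_norml => /andP[_ h1] h2 h3.
  by move: he; rewrite /rho; set E := min_spectrum _ in h3 * => he; apply/andP; split; lra.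
have [q [q1 hq]] := whp_localized hV hlambda l1.
(* The constant is fixed before any event is available to show [0 <= q], and it must be nonnegative
   for [M * g] to be replaced by the smaller [kappa * sqrt M]. *)
exists (Num.max 0 q / (1 - q) ^+ 2); apply: whp_impl hq.
near=> M => w [i0 [g [ui0 g0 kg gap S]]].
have [M2 _ k0 _] : [/\ (2 <= M)%N, 0 < log_scale R M, 0 < kappa lambda M &
    kappa lambda M <= 1] by near: M; exact: kappa_small.
have M0 : 0 < M%:R :> R by rewrite ltr0n ltnW.
have := gs M w M2; rewrite HE => /(localized_ratio q1 g0 gap S) /andP[-> /le_trans] /=.
apply; rewrite lerD2l.
have q2 : 0 < (1 - q) ^+ 2 by rewrite exprn_gt0 // subr_gt0.
apply: (@le_trans _ _ (Num.max 0 q / (1 - q) ^+ 2 / (M%:R * g))).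
  rewrite ler_pM2r ?invr_gt0 ?mulr_gt0 // ler_pM2r ?invr_gt0 //.
  by rewrite le_max lexx orbT.
rewrite ler_wpM2l ?divr_ge0 ?(ltW q2) //; first by rewrite le_max lexx.
by rewrite lef_pV2 // posrE mulr_gt0 // sqrtr_gt0.
Unshelve. all: by end_near. Qed.
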